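(* There exist absolute constants $\epsilon>0$ and $C\ge c>0$ such that for all integers $d\ge 0$, $n\ge 1$ and every function $f:\mathbb{F}_2^n\to\mathbb{F}_2$: if $\|f\|_{U^{d+1}}\ge 1-\epsilon/2^d$, then $\delta_d(f)=\Theta(1-\|f\|_{U^{d+1}})$, i.e. $$c\,(1-\|f\|_{U^{d+1}})\ \le\ \delta_d(f)\ \le\ C\,(1-\|f\|_{U^{d+1}}).$$
   Context: Every function $f:\mathbb{F}_2^n\to\mathbb{F}_2$ is uniquely a multilinear polynomial over $\mathbb{F}_2$; $\deg f$ is its degree. $\delta_d(f)=\min\{\Pr_{x\in\mathbb{F}_2^n}[f(x)\ne g(x)] : g:\mathbb{F}_2^n\to\mathbb{F}_2,\ \deg g\le d\}$, with $x$ uniform. The $k$th Gowers norm test $T_{\mathrm{GN}(k)}^f$ picks $x,a_1,\dots,a_k\in\mathbb{F}_2^n$ uniformly and independently and accepts if and only if the $k$-fold derivative vanishes, i.e. $\sum_{J\subseteq[k]} f(x+\sum_{j\in J}a_j)=0$ in $\mathbb{F}_2$ (equivalently, iff $f$ restricted to $x+\mathrm{span}(a_1,\dots,a_k)$ has degree at most $k-1$). The $k$th Gowers norm of $f$ is $$\|f\|_{U^k}=\left(\Pr[T_{\mathrm{GN}(k)}^f\text{ accepts}]-\Pr[T_{\mathrm{GN}(k)}^f\text{ rejects}]\right)^{1/2^k}.$$ *)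

(* Defs.v *)
From mathcomp Require Import all_boot all_order all_algebra.
From mathcomp Require Import reals exp.

Set Implicit Arguments.
Unset Strict Implicit.
Unset Printing Implicit Defensive.

Import Order.TTheory GRing.Theory Num.Theory.
Local Open Scope ring_scope.

Definition boolfun (n : nat) := {ffun 'rV['F_2]_n -> 'F_2}.

(* A multilinear polynomial in n variables: [c S] is the coefficient of the
   monomial \prod_(i in S) x_i. *)
Definition mlpoly (n : nat) := {ffun {set 'I_n} -> 'F_2}.

Definition mleval n (c : mlpoly n) : boolfun n :=
  [ffun x : 'rV['F_2]_n => \sum_(S : {set 'I_n}) c S * \prod_(i in S) x 0 i].

(* The zero polynomial gets degree 0. *)
Definition mldeg n (c : mlpoly n) : nat :=
  \max_(S : {set 'I_n} | c S != 0) #|S|.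

Lemma mleval_inj n : injective (@mleval n).
Proof.
move=> c c' ecc'; apply/ffunP => S.
have [m] := ubnP #|S|; elim: m S => // m IHm S; rewrite ltnS => leSm.
pose x : 'rV['F_2]_n := \row_i (i \in S)%:R.
have ev (b : mlpoly n) :
    mleval b x = b S + \sum_(T : {set 'I_n} | T \proper S) b T.
  rewrite ffunE (bigD1 S) //= big1 => [|i iS]; last by rewrite mxE iS.
  rewrite mulr1; congr (_ + _).
  rewrite [RHS]big_mkcond [LHS]big_mkcond /=.
  apply: eq_bigr => T _; rewrite properEneq.
  case: eqP => //= _; case: (boolP (T \subset S)) => [sTS|/subsetPn[i iT iS]].
    by rewrite big1 ?mulr1 // => i iT; rewrite mxE (subsetP sTS).
  by rewrite (bigD1 i) //= mxE (negPf iS) mul0r mulr0.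
have := congr1 (fun g : boolfun n => g x) ecc'; rewrite !ev.
rewrite (eq_bigr c') => [/addIr//|T /proper_card ltTS].
by apply: IHm; apply: leq_trans leSm.
Qed.

Lemma mleval_bij n : bijective (@mleval n).
Proof.
apply: inj_card_bij; first exact: mleval_inj.
by rewrite !card_ffun card_mx !card_Fp // mul1n -cardsT -powersetT
  card_powerset cardsT card_ord.
Qed.

Definition mlpoly_of n (f : boolfun n) : mlpoly n :=
  odflt [ffun=> 0] [pick c | mleval c == f].

Lemma mlpoly_ofK n (f : boolfun n) : mleval (mlpoly_of f) = f.
Proof.
rewrite /mlpoly_of; case: pickP => [c /eqP//|noc].
by have [g _ gK] := mleval_bij n; have /eqP := noc (g f); rewrite gK.
Qed.

Lemma mlevalK n (c : mlpoly n) : mlpoly_of (mleval c) = c.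
Proof. by apply: mleval_inj; rewrite mlpoly_ofK. Qed.

Definition deg n (f : boolfun n) : nat := mldeg (mlpoly_of f).

Lemma deg0 n : deg ([ffun=> 0] : boolfun n) = 0%N.
Proof.
have <- : mleval ([ffun=> 0] : mlpoly n) = [ffun=> 0].
  by apply/ffunP => x; rewrite !ffunE big1 // => S _; rewrite ffunE mul0r.
by rewrite /deg mlevalK /mldeg big1 // => S; rewrite ffunE eqxx.
Qed.

Definition prob (R : realType) (T : finType) (P : pred T) : R :=
  #|P|%:R / #|T|%:R.

Definition dist (R : realType) n (f g : boolfun n) : R :=
  prob R [pred x : 'rV['F_2]_n | f x != g x].

(* The neutral element 1 of the minimum does not affect the value: see
   [delta_le] and [delta_attained]. *)
Definition delta (R : realType) (d n : nat) (f : boolfun n) : R :=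
  \big[Num.min/1]_(g : boolfun n | (deg g <= d)%N) dist R f g.

Lemma delta_le (R : realType) d n (f g : boolfun n) :
  (deg g <= d)%N -> delta R d f <= dist R f g.
Proof. by move=> gd; rewrite /delta (bigD1 g) //= ge_min lexx. Qed.

Lemma dist_le1 (R : realType) n (f g : boolfun n) : dist R f g <= 1.
Proof.
rewrite /dist /prob ler_pdivrMr ?mul1r ?ler_nat ?max_card //.
by rewrite ltr0n; apply/card_gt0P; exists 0.
Qed.

Lemma delta_attained (R : realType) d n (f : boolfun n) :
  exists2 g : boolfun n, (deg g <= d)%N & delta R d f = dist R f g.
Proof.
pose g0 : boolfun n := [ffun=> 0].
have g0d : (deg g0 <= d)%N by rewrite deg0.
rewrite /delta (bigmin_eq_arg _ g0) // => [|g _]; last exact: dist_le1.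
by case: arg_minP => // g gd _; exists g.
Qed.

(* A sample (x, a) consists of a base point x and directions a_1, ..., a_k. *)
Definition gowers_accepts k n (f : boolfun n) :
    pred ('rV['F_2]_n * {ffun 'I_k -> 'rV['F_2]_n}) :=
  fun xa => \sum_(J : {set 'I_k}) f (xa.1 + \sum_(j in J) xa.2 j) == 0.

(* For k >= 1 the base of the power is nonnegative: it averages over
   a_1, ..., a_(k-1) the square of the mean over x of the sign
   (-1) ^ (D_(a_1) ... D_(a_(k-1)) f (x)), where D_a is the derivative in
   direction a. *)
Definition gowers_norm (R : realType) k n (f : boolfun n) : R :=
  (prob R (@gowers_accepts k n f) - prob R (predC (@gowers_accepts k n f)))
    `^ (2 ^+ k)^-1.

(* Main.v *)
Require Import Defs.
From mathcomp Require Import all_boot all_order all_algebra.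
From mathcomp Require Import reals exp.
From mathcomp Require Import ring lra zify.
Import Order.TTheory GRing.Theory Num.Theory.
Local Open Scope ring_scope.

(**
Let k = d + 1 and let rho be the rejection probability of the test. Since
||f||^(2^k) = 1 - 2 rho, it suffices to show rho ~ 2^d delta when rho is small,
and rho <= 2^k delta is a union bound.

If delta <= 2^-(k+1), a second-moment estimate for the number of vertices of a
random parallelepiped at which f differs from the closest polynomial gives
rho >= 2^d delta. It remains to bound rho from below by a constant for functions
that are "far", i.e. at distance at least 2^-(k+3) from degree d. This is an
induction on n, along the lines of Bhattacharyya, Kopparty, Schoenebeck, Sudan
and Zuckerman: rho(f) is at least the average of rho(f|H) over all hyperplanes H.
If f|H is far for most H, the induction hypothesis applies. Otherwise f|H is
close to a polynomial P_H for more than 2^k normal directions; the P_H agree on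
intersections by the minimum distance of Reed-Muller codes, hence are the
restrictions of one polynomial P of degree at most d. As the hyperplanes cover
the space almost evenly, P is so close to f that the second-moment estimate
applies. The induction starts at n = k, where all functions of degree n have the
same rejection probability as the indicator function of a point.
*)

Set Implicit Arguments.
Unset Strict Implicit.
Unset Printing Implicit Defensive.

(** * Arithmetic in characteristic 2 *)

Lemma F2P (b : 'F_2) : b = 0 \/ b = 1.
Proof. by case: b => [[|[|m]] lt] //; [left|right]; apply: val_inj. Qed.

Lemma addF2 (b : 'F_2) : b + b = 0.
Proof. by case: (F2P b) => ->; apply: val_inj. Qed.

Lemma addV2 n (x : 'rV['F_2]_n) : x + x = 0.
Proof. by apply/rowP => i; rewrite !mxE addF2. Qed.

Lemma addVK n (a x : 'rV['F_2]_n) : x + a + a = x.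
Proof. by rewrite -addrA addV2 addr0. Qed.

Lemma addbf2 n (f : boolfun n) : f + f = 0.
Proof. by apply/ffunP => x; rewrite !ffunE addF2. Qed.

Lemma addF2_eq0 (a b : 'F_2) : a + b = 0 -> a = b.
Proof. by move/eqP; rewrite addr_eq0 => /eqP ->; apply: val_inj; case: (F2P b) => ->. Qed.

(** * Averages over the cube, indicators and signs *)

Section Average.
Variable R : realFieldType.
Implicit Type n : nat.

Definition avg n (F : 'rV['F_2]_n -> R) : R := (\sum_x F x) / 2 ^+ n.

Lemma eq_avg n (F G : 'rV['F_2]_n -> R) : F =1 G -> avg F = avg G.
Proof. by move=> FG; rewrite /avg (eq_bigr _ (fun x _ => FG x)). Qed.

Lemma card_F2V n : #|{: 'rV['F_2]_n}| = (2 ^ n)%N.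
Proof. by rewrite card_mx card_Fp // mul1n. Qed.

Lemma avg_const n (c : R) : avg (fun _ : 'rV['F_2]_n => c) = c.
Proof.
rewrite /avg sumr_const card_F2V -(mulr_natr c) natrX mulfK //.
by rewrite expf_neq0 // pnatr_eq0.
Qed.

Lemma avgD n (F G : 'rV['F_2]_n -> R) : avg (fun x => F x + G x) = avg F + avg G.
Proof. by rewrite /avg big_split mulrDl. Qed.

Lemma avgZ n c (F : 'rV['F_2]_n -> R) : avg (fun x => c * F x) = c * avg F.
Proof. by rewrite /avg -mulr_sumr mulrA. Qed.

Lemma avgB n (F G : 'rV['F_2]_n -> R) : avg (fun x => F x - G x) = avg F - avg G.
Proof. by rewrite /avg sumrB mulrBl. Qed.

Lemma le_avg n (F G : 'rV['F_2]_n -> R) : (forall x, F x <= G x) -> avg F <= avg G.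
Proof. by move=> FG; rewrite /avg ler_wpM2r ?invr_ge0 ?exprn_ge0 // ler_sum. Qed.

Lemma avg_ge0 n (F : 'rV['F_2]_n -> R) : (forall x, 0 <= F x) -> 0 <= avg F.
Proof. by move=> F0; rewrite -(avg_const n 0); exact: le_avg. Qed.

Lemma avg_shift n a (F : 'rV['F_2]_n -> R) : avg (fun x => F (x + a)) = avg F.
Proof.
rewrite /avg; congr (_ / _); symmetry.
exact: (reindex_inj (addIr a)).
Qed.

Lemma avg_shiftl n a (F : 'rV['F_2]_n -> R) : avg (fun x => F (a + x)) = avg F.
Proof. by rewrite -(avg_shift a F); apply: eq_avg => x; rewrite addrC. Qed.

Lemma avg_sum n (I : finType) (A : pred I) (F : I -> 'rV['F_2]_n -> R) :
  avg (fun x => \sum_(i in A) F i x) = \sum_(i in A) avg (F i).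
Proof. by rewrite /avg exchange_big mulr_suml. Qed.

Lemma avg_exch n m (F : 'rV['F_2]_n -> 'rV['F_2]_m -> R) :
  avg (fun x => avg (F x)) = avg (fun y => avg (F^~ y)).
Proof. by rewrite /avg -!mulr_suml exchange_big /= -!mulrA [X in _ * X]mulrC. Qed.

Definition nz (b : 'F_2) : R := (b != 0)%:R.

Lemma nz0 : nz 0 = 0. Proof. by []. Qed.
Lemma nz1 : nz 1 = 1. Proof. by []. Qed.

Lemma nz_ge0 b : 0 <= nz b. Proof. exact: ler0n. Qed.
Lemma nz_le1 b : nz b <= 1. Proof. by case: (F2P b) => ->; rewrite ?nz0 ?nz1 //; lra. Qed.

Lemma nzD a b : nz (a + b) = nz a + nz b - 2 * (nz a * nz b).
Proof.
case: (F2P a) => ->; case: (F2P b) => ->; rewrite ?addr0 ?add0r ?addF2 ?nz0 ?nz1; ring.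
Qed.

Lemma nzM a b : nz (a * b) = nz a * nz b.
Proof. by case: (F2P a) => ->; rewrite ?mul0r ?mul1r ?nz0 ?nz1 ?mul0r ?mul1r. Qed.

Lemma nzD_le a b : nz (a + b) <= nz a + nz b.
Proof. by rewrite nzD; have := nz_ge0 a; have := nz_ge0 b; nra. Qed.

Definition chi (b : 'F_2) : R := 1 - 2 * nz b.

Lemma chiD a b : chi (a + b) = chi a * chi b.
Proof. by rewrite /chi nzD; ring. Qed.

End Average.

(** * Derivatives and degree *)

Section Deriv.
Variable n : nat.
Implicit Types (f g h p : boolfun n) (a b x : 'rV['F_2]_n).

Definition D a g : boolfun n := [ffun x => g x + g (x + a)].

Lemma DD a f g : D a (f + g) = D a f + D a g.
Proof. by apply/ffunP => x; rewrite !ffunE addrACA. Qed.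

Lemma D0 a : D a 0 = 0.
Proof. by apply/ffunP => x; rewrite !ffunE addr0. Qed.

(* deg g < k, see [deg_lowdeg] *)
Fixpoint lowdeg k g : bool :=
  if k is k'.+1 then [forall a, lowdeg k' (D a g)] else g == 0.

Lemma lowdegS k g : reflect (forall a, lowdeg k (D a g)) (lowdeg k.+1 g).
Proof. exact: forallP. Qed.

Lemma lowdeg0 k : lowdeg k 0.
Proof. by elim: k => [|k IH] /=; [|apply/forallP => a; rewrite D0]. Qed.

Lemma lowdegD k f g : lowdeg k f -> lowdeg k g -> lowdeg k (f + g).
Proof.
elim: k f g => [|k IH] f g; first by move=> /eqP -> /eqP ->; rewrite /= addr0.
by move=> /lowdegS fk /lowdegS gk; apply/lowdegS => a; rewrite DD IH.
Qed.

Lemma lowdeg_sum (I : finType) (A : pred I) k (F : I -> boolfun n) :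
  (forall i, A i -> lowdeg k (F i)) -> lowdeg k (\sum_(i | A i) F i).
Proof.
by move=> Fk; apply: (big_ind (fun g => lowdeg k g)) => //;
  [exact: lowdeg0 | move=> f g; apply: lowdegD].
Qed.

Lemma lowdegSW k g : lowdeg k g -> lowdeg k.+1 g.
Proof.
elim: k g => [|k IH] g; first by move=> /eqP ->; exact: lowdeg0.
by move=> /lowdegS gk; apply/lowdegS => a; apply: IH.
Qed.

Lemma lowdegW j k g : (j <= k)%N -> lowdeg j g -> lowdeg k g.
Proof. by move=> /subnK <- gj; elim: (k - j)%N => //= m IH; apply: lowdegSW. Qed.

End Deriv.

(** In characteristic 2, [phi a + phi 0] is the value at [a] of the linear part of [phi]. It is the
    direction in which [g] is differentiated when [g \o phi] is differentiated along [a]. *)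
Definition affine m n (phi : 'rV['F_2]_m -> 'rV['F_2]_n) :=
  forall x a, phi (x + a) = phi x + (phi a + phi 0).

Lemma lowdeg_comp m n (phi : 'rV['F_2]_m -> 'rV['F_2]_n) k (g : boolfun n) :
  affine phi -> lowdeg k g -> lowdeg k ([ffun y => g (phi y)] : boolfun m).
Proof.
move=> aphi; elim: k g => [|k IH] g.
  by move=> /eqP ->; apply/eqP/ffunP => y; rewrite !ffunE.
move=> /lowdegS gk; apply/lowdegS => a.
suff -> : D a [ffun y => g (phi y)] = [ffun y => D (phi a + phi 0) g (phi y)].
  exact: IH.
by apply/ffunP => y; rewrite !ffunE aphi.
Qed.

(** * Linear forms and the minimum distance of Reed-Muller codes *)

Section Dot.
Variable n : nat.
Implicit Types (l x e : 'rV['F_2]_n).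

Definition dot l x : 'F_2 := \sum_i l 0 i * x 0 i.

Lemma dotC l x : dot l x = dot x l.
Proof. by apply: eq_bigr => i _; rewrite mulrC. Qed.

Lemma dotDr l x y : dot l (x + y) = dot l x + dot l y.
Proof. by rewrite /dot -big_split; apply: eq_bigr => i _; rewrite mxE mulrDr. Qed.

Lemma dotDl l l' x : dot (l + l') x = dot l x + dot l' x.
Proof. by rewrite dotC dotDr !(dotC x). Qed.

Lemma dot0r l : dot l 0 = 0.
Proof. by rewrite /dot big1 // => i _; rewrite mxE mulr0. Qed.

Lemma dot0l x : dot 0 x = 0.
Proof. by rewrite dotC dot0r. Qed.

Lemma dotZr l (c : 'F_2) x : dot l (c *: x) = c * dot l x.
Proof. by rewrite /dot mulr_sumr; apply: eq_bigr => i _; rewrite mxE mulrCA. Qed.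

Lemma dot_delta l i : dot l (delta_mx 0 i) = l 0 i.
Proof.
rewrite /dot (bigD1 i) //= mxE !eqxx mulr1 big1 ?addr0 // => j ji.
by rewrite mxE (negPf ji) andbF mulr0.
Qed.

Lemma dot_neq0 l : l != 0 -> exists i, l 0 i = 1.
Proof.
move=> l0; case: (pickP (fun i => l 0 i != 0)) => [i li|all0].
  by exists i; case: (F2P (l 0 i)) li => ->.
by case/eqP: l0; apply/rowP => i; rewrite mxE; apply/eqP/negbFE/all0.
Qed.

Lemma dot_nondeg l : (forall x, dot l x = 0) -> l = 0.
Proof. by move=> l0; apply/rowP => i; rewrite mxE -dot_delta l0. Qed.

Lemma avg_chi (R : realFieldType) l : avg (fun x => chi R (dot l x)) = (l == 0)%:R.
Proof.
case: eqP => [->|/eqP /dot_neq0 [i li]].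
  by rewrite -[RHS](avg_const n); apply: eq_avg => x; rewrite dot0l /chi nz0 mulr0 subr0.
(* Translation along a coordinate where [l] is 1 flips every sign, so the average equals its own
   negative. *)
have E : avg (fun x => chi R (dot l x)) = - avg (fun x => chi R (dot l x)).
  rewrite -{1}(avg_shift (delta_mx 0 i)) -mulN1r -avgZ; apply: eq_avg => x.
  by rewrite dotDr dot_delta li chiD {2}/chi nz1; ring.
by rewrite mulr0n; lra.
Qed.

End Dot.

(** Product rule: the derivative along [a] is [D a f] times the same form, plus [dot l a] times a
    translate of [f], and translation preserves degree. *)
Lemma lowdeg_mulform n k (f : boolfun n) l c :
  lowdeg k f -> lowdeg k.+1 ([ffun x => f x * (dot l x + c)] : boolfun n).
Proof.
elim: k f => [|k IH] f fk.
  apply: lowdegSW; rewrite (eqP fk); apply/eqP/ffunP => x; by rewrite !ffunE mul0r.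
apply/lowdegS => a.
have -> : D a [ffun x => f x * (dot l x + c)] =
    [ffun x => D a f x * (dot l x + c)] + [ffun x => dot l a * f (x + a)].
  apply/ffunP => x; rewrite !ffunE dotDr; ring.
apply: lowdegD; first by apply: IH; move/lowdegS: fk.
case: (F2P (dot l a)) => ->.
  have -> : [ffun x => 0 * f (x + a)] = 0 :> boolfun n.
    by apply/ffunP => x; rewrite !ffunE mul0r.
  exact: lowdeg0.
have -> : [ffun x => 1 * f (x + a)] = [ffun x => f (x + a)] :> boolfun n.
  by apply/ffunP => x; rewrite !ffunE mul1r.
apply: (lowdeg_comp (phi := fun x => x + a)) => // x b.
by rewrite add0r addVK addrAC.
Qed.

(** Minimum distance of Reed-Muller codes. A derivative of [g] has at most twice the support of [g],
    so one nonzero derivative suffices for the induction; if all derivatives vanish, [g] already has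
    degree 0. *)
Lemma lowdeg_dist (R : realFieldType) n k (g : boolfun n) :
  lowdeg k.+1 g -> g != 0 -> 2 ^- k <= avg (fun x => nz R (g x)).
Proof.
elim: k g => [|k IH] g gk g0.
  have [x gx] : exists x, g x = 1.
    case: (pickP (fun x => g x != 0)) => [x gx|all0].
      by exists x; case: (F2P (g x)) gx => ->.
    by case/eqP: g0; apply/ffunP => x; rewrite ffunE; apply/eqP/negbFE/all0.
  rewrite expr0 invr1 -[X in X <= _](avg_const n) le_avg // => y.
  have /lowdegS /(_ (x + y)) /eqP /ffunP /(_ y) := gk; rewrite !ffunE.
  by rewrite [y + _]addrC addVK gx => /addF2_eq0 ->; rewrite nz1.
have [|] := boolP [forall a, D a g == 0].
  move=> /forallP Dg0; have g1 : lowdeg 1 g by apply/lowdegS => a; apply: Dg0.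
  apply: le_trans (IH g (lowdegW (ltn0Sn k) g1) g0).
  rewrite lef_pV2 ?posrE ?exprn_gt0 // exprS ler_peMl ?exprn_ge0 //. lra.
rewrite negb_forall => /existsP [a Da0].
have {}IH := IH _ (lowdegS _ _ gk a) Da0.
have : avg (fun x => nz R (D a g x)) <= 2 * avg (fun x => nz R (g x)).
  have -> : 2 * avg (fun x => nz R (g x)) =
      avg (fun x => nz R (g x) + nz R (g (x + a))).
    by rewrite avgD (avg_shift a (fun x => nz R (g x))); ring.
  by apply: le_avg => x; rewrite ffunE nzD_le.
by move=> /(le_trans IH); rewrite exprS invfM; lra.
Qed.

(** * The rejection probability compared with the distance *)

Section Rho.
Variable R : realFieldType.
Variable n : nat.
Implicit Types (g h p : boolfun n) (a b x : 'rV['F_2]_n).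

(* the rejection probability of the k-th Gowers norm test, see [prob_reject] *)
Fixpoint rho k g : R :=
  if k is k'.+1 then avg (fun a => rho k' (D a g)) else avg (fun x => nz R (g x)).

Lemma rho_ge0 k g : 0 <= rho k g.
Proof.
by elim: k g => [|k IH] g; apply: avg_ge0 => x; [exact: nz_ge0 | exact: IH].
Qed.

Lemma rho0 k : rho k 0 = 0.
Proof.
elim: k => [|k IH] /=; rewrite -[RHS](avg_const n); apply: eq_avg => x.
  by rewrite ffunE.
by rewrite D0.
Qed.

Lemma rho_lowdegD k g p : lowdeg k p -> rho k (g + p) = rho k g.
Proof.
elim: k g p => [|k IH] g p; first by move=> /eqP ->; rewrite addr0.
by move=> /lowdegS pk; apply: eq_avg => a; rewrite DD; apply: IH.
Qed.

Lemma rho_lowdeg k p : lowdeg k p -> rho k p = 0.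
Proof. by move=> pk; rewrite -[p]add0r rho_lowdegD ?rho0. Qed.

(** Union bound over the 2^k vertices of the parallelepiped. *)
Lemma rho_le k g : rho k g <= 2 ^+ k * avg (fun x => nz R (g x)).
Proof.
elim: k g => [|k IH] g; first by rewrite mul1r.
have -> : 2 ^+ k.+1 * avg (fun x => nz R (g x)) =
    avg (fun a => 2 ^+ k * avg (fun x => nz R (g x) + nz R (g (x + a)))).
  rewrite -[LHS](avg_const n); apply: eq_avg => a.
  by rewrite avgD (avg_shift a (fun x => nz R (g x))) exprS; ring.
apply: le_avg => a; apply: le_trans (IH _) _.
rewrite ler_wpM2l ?exprn_ge0 //; apply: le_avg => x.
by rewrite ffunE nzD_le.
Qed.

(** For one direction the bias is the square of the mean sign of [g]; further directions average
    biases of derivatives. This makes the base of the power in [gowers_norm] nonnegative. *)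
Lemma rho_bias_ge0 k g : 0 <= 1 - 2 * rho k.+1 g.
Proof.
elim: k g => [|k IH] g.
  suff -> : 1 - 2 * rho 1 g = avg (fun x => chi R (g x)) ^+ 2 by apply: sqr_ge0.
  rewrite /= expr2 -avgZ -[X in X - _](avg_const n) -avgZ -avgB.
  transitivity (avg (fun a => avg (fun x => chi R (g x) * chi R (g (x + a))))).
    apply: eq_avg => a; rewrite -avgZ -[X in X - _](avg_const n) -avgB.
    by apply: eq_avg => x; rewrite -chiD ffunE.
  rewrite avg_exch; apply: eq_avg => x.
  by rewrite avgZ (avg_shiftl x (fun y => chi R (g y))) mulrC.
have -> : 1 - 2 * rho k.+2 g = avg (fun a => 1 - 2 * rho k.+1 (D a g)).
  by rewrite avgB avg_const avgZ.
by apply: avg_ge0 => a.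
Qed.

(* For u a sum of indicators of parity h, the bound is a second-moment
   lower bound on the probability that u takes the value 1 on a random
   parallelepiped. *)
Lemma rho_ge_count k h (u : 'rV['F_2]_n -> nat) :
    (forall x, (u x)%:R = h x) ->
  2 * 2 ^+ k * avg (fun x => (u x)%:R) - 2 ^+ k * avg (fun x => (u x)%:R ^+ 2)
    - (4 ^+ k - 2 ^+ k) * avg (fun x => (u x)%:R) ^+ 2 <= rho k h.
Proof.
elim: k h u => [|k IH] h u uh.
  (* Pointwise, [2 * u - u ^ 2] is 1 at [u = 1] and at most 0 at every other natural number. *)
  rewrite !expr0 subrr mul0r subr0 mulr1 mul1r -avgZ -avgB.
  apply: le_avg => x; rewrite -uh.
  case: (u x) => [|[|m]]; first by rewrite nz0 expr0n /=; lra.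
    by rewrite nz1; lra.
  apply: le_trans (nz_ge0 _ _); rewrite -natrX -natrM subr_le0 ler_nat; nia.
(* The count is kept in the integers rather than mod 2, so its first two moments stay computable;
   only its parity is the derivative. *)
pose v a x := (u x + u (x + a)%R)%N.
have vh a x : (v a x)%:R = D a h x by rewrite natrD !uh ffunE.
apply: le_trans (le_avg (fun a => IH _ _ (vh a))).
have E1 a : avg (fun x => (v a x)%:R : R) = 2 * avg (fun x => (u x)%:R).
  have -> : avg (fun x => (v a x)%:R : R) = avg (fun x => (u x)%:R + (u (x + a))%:R).
    by apply: eq_avg => x; rewrite natrD.
  by rewrite avgD (avg_shift a (fun x => (u x)%:R)); ring.
have E2 : avg (fun a => avg (fun x => (v a x)%:R ^+ 2 : R)) =
    2 * avg (fun x => (u x)%:R ^+ 2) + 2 * avg (fun x => (u x)%:R) ^+ 2.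
  have -> : avg (fun a => avg (fun x => (v a x)%:R ^+ 2 : R)) =
      avg (fun a => avg (fun x => (u x)%:R ^+ 2) + avg (fun x => (u x)%:R ^+ 2)
         + 2 * avg (fun x => (u x)%:R * (u (x + a))%:R)).
    apply: eq_avg => a; rewrite -{2}(avg_shift a (fun x => (u x)%:R ^+ 2)).
    rewrite -avgZ -!avgD; apply: eq_avg => x; rewrite natrD; ring.
  rewrite avgD avg_const avgZ avg_exch.
  have -> : avg (fun x => avg (fun a => (u x)%:R * (u (x + a))%:R : R)) =
      avg (fun x => avg (fun y => (u y)%:R) * (u x)%:R).
    by apply: eq_avg => x; rewrite avgZ (avg_shiftl x (fun y => (u y)%:R)) mulrC.
  by rewrite avgZ; ring.
have -> : avg (fun a => 2 * 2 ^+ k * avg (fun x => (v a x)%:R)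
      - 2 ^+ k * avg (fun x => (v a x)%:R ^+ 2)
      - (4 ^+ k - 2 ^+ k) * avg (fun x => (v a x)%:R) ^+ 2) =
    2 * 2 ^+ k * (2 * avg (fun x => (u x)%:R))
    - 2 ^+ k * (2 * avg (fun x => (u x)%:R ^+ 2) + 2 * avg (fun x => (u x)%:R) ^+ 2)
    - (4 ^+ k - 2 ^+ k) * (2 * avg (fun x => (u x)%:R)) ^+ 2 :> R.
  rewrite -E2 avgB avgB !avgZ; congr (_ - _ - _).
    by rewrite -[X in _ * X = _]/(avg _) (eq_avg E1) avg_const.
  congr (_ * _); rewrite -[RHS](avg_const n); apply: eq_avg => a; by rewrite E1.
by rewrite !exprS le_eqVlt; apply/orP; left; apply/eqP; ring.
Qed.

(** For the 0/1 indicator both moments in [rho_ge_count] equal [dl]; a nonnegative term 2^k dl^2 is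
    dropped. *)
Lemma rho_ge k h (dl : R) : dl = avg (fun x => nz R (h x)) ->
  2 ^+ k * dl * (1 - 2 ^+ k * dl) <= rho k h.
Proof.
move=> dlE; have uh x : ((h x != 0) : nat)%:R = h x by case: (F2P (h x)) => ->.
apply: le_trans (rho_ge_count k uh).
have -> : avg (fun x => (h x != 0)%:R ^+ 2 : R) = dl.
  by rewrite dlE; apply: eq_avg => x; rewrite /nz; case: (h x != 0); rewrite ?expr1n ?expr0n.
rewrite -[avg _]dlE.
have -> : 4 ^+ k = 2 ^+ k * 2 ^+ k :> R.
  by rewrite -exprMn; congr (_ ^+ _); ring.
have := exprn_ge0 k (ler0n R 2); have := sqr_ge0 dl; nra.
Qed.

End Rho.

(** * Degree by derivatives agrees with degree by coefficients *)

Section Coefficients.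
Variable n : nat.
Implicit Types (c : mlpoly n) (g : boolfun n).

Lemma mlevalD c c' : mleval (c + c') = mleval c + mleval c'.
Proof.
apply/ffunP => x; rewrite !ffunE -big_split; apply: eq_bigr => S _ /=.
by rewrite ffunE mulrDl.
Qed.

Lemma mlpoly_ofD (f g : boolfun n) : mlpoly_of (f + g) = mlpoly_of f + mlpoly_of g.
Proof. by apply: mleval_inj; rewrite mlevalD !mlpoly_ofK. Qed.

Lemma lowdeg_monomial (S : {set 'I_n}) :
  lowdeg #|S|.+1 ([ffun x : 'rV['F_2]_n => \prod_(i in S) x 0 i] : boolfun n).
Proof.
have [m] := ubnP #|S|; elim: m S => // m IH S; rewrite ltnS => leS.
have [->|/set0Pn [i iS]] := eqVneq S set0.
  rewrite cards0; apply/lowdegS => a; apply/eqP/ffunP => x.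
  by rewrite !ffunE !big_set0 addF2.
have := cardsD1 i S; rewrite iS add1n => cS.
have := lowdeg_mulform (delta_mx 0 i) 0 (IH (S :\ i) _); rewrite -cS => /(_ leS).
congr (lowdeg _ _); apply/ffunP => x; rewrite !ffunE addr0 dotC dot_delta.
rewrite [RHS](bigD1 i) //= mulrC; congr (_ * _); apply: eq_bigl => j.
by rewrite !inE andbC.
Qed.

Lemma mlevalE c :
  mleval c = \sum_(S : {set 'I_n} | c S != 0)
    ([ffun x : 'rV['F_2]_n => \prod_(i in S) x 0 i] : boolfun n).
Proof.
apply/ffunP => x; rewrite ffunE sum_ffunE [RHS]big_mkcond /=.
apply: eq_bigr => S _; rewrite ffunE.
by case: (F2P (c S)) => ->; rewrite ?eqxx ?mul0r ?mul1r.
Qed.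

(** Differentiation along a basis vector is the formal partial derivative: monomials without [i]
    cancel mod 2, the others lose the factor [x 0 i]. *)
Lemma D_mleval c (i : 'I_n) :
  D (delta_mx 0 i) (mleval c) =
  mleval ([ffun S : {set 'I_n} => if i \in S then 0 else c (i |: S)] : mlpoly n).
Proof.
apply/ffunP => x; rewrite !ffunE -big_split /=.
rewrite (bigID (fun S : {set 'I_n} => i \in S)) /= [X in _ + X]big1 ?addr0; last first.
  move=> S iS; apply/eqP; rewrite addr_eq0; apply/eqP.
  rewrite -[RHS]add0r -[X in X - _](addF2 (c S * \prod_(j in S) x 0 j)) -addrA.
  suff -> : \prod_(j in S) (x + delta_mx 0 i) 0 j = \prod_(j in S) x 0 j.
    by rewrite subrr addr0.
  apply: eq_bigr => j jS; rewrite !mxE eqxx; case: eqP => [ji|]; last by rewrite addr0.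
  by rewrite -ji jS in iS.
rewrite [RHS](bigID (fun S : {set 'I_n} => i \in S)) /= [X in _ = X + _]big1 ?add0r;
  last first.
  by move=> S iS; rewrite ffunE iS mul0r.
rewrite (reindex_onto (fun S => i |: S) (fun S => S :\ i)) /=; last first.
  by move=> S iS; rewrite setD1K.
apply: eq_big => [S|S /andP[_ /eqP SE]].
  rewrite setU11 /=; apply/eqP/idP => [<-|iS]; first by rewrite !inE eqxx.
  by rewrite setU1K.
have iS : i \notin S by rewrite -SE !inE eqxx.
rewrite ffunE (negPf iS) -mulrDr; congr (_ * _).
rewrite !big_setU1 //= !mxE !eqxx mulrDl.
have -> : \prod_(j in S) (x + delta_mx 0 i) 0 j = \prod_(j in S) x 0 j.
  apply: eq_bigr => j jS; rewrite !mxE eqxx; case: eqP => [ji|]; last by rewrite addr0.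
  by rewrite -ji jS in iS.
by rewrite mul1r addrA addF2 add0r.
Qed.

(** A partial derivative in a variable of [S] moves the coefficient of [S] to a set with one element
    less. *)
Lemma lowdeg_coef k c : lowdeg k (mleval c) ->
  forall S : {set 'I_n}, (k <= #|S|)%N -> c S = 0.
Proof.
elim: k c => [|k IH] c.
  move=> /eqP c0 S _.
  have -> : c = 0; last by rewrite ffunE.
  apply: mleval_inj; rewrite c0; apply/ffunP => x; rewrite !ffunE big1 // => T _.
  by rewrite ffunE mul0r.
move=> /lowdegS ck S kS; have /card_gt0P [i iS] := leq_trans (ltn0Sn k) kS.
have := ck (delta_mx 0 i); rewrite D_mleval => /IH /(_ (S :\ i)).
rewrite ffunE !inE eqxx /= setD1K //; apply.
by move: kS; rewrite (cardsD1 i S) iS add1n ltnS.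
Qed.

Lemma deg_lowdeg d g : (deg g <= d)%N = lowdeg d.+1 g.
Proof.
rewrite /deg /mldeg; apply/bigmax_leqP/idP => [le_d|].
  rewrite -[g]mlpoly_ofK mlevalE; apply: lowdeg_sum => S cS.
  by apply: lowdegW (lowdeg_monomial S); rewrite ltnS le_d.
rewrite -{1}[g]mlpoly_ofK => /lowdeg_coef c0 S; apply: contraNT.
by rewrite -ltnNge => /c0 ->.
Qed.

Lemma lowdeg_dim k g : (n < k)%N -> lowdeg k g.
Proof.
case: k => // k nk; rewrite -deg_lowdeg; apply/bigmax_leqP => S _.
by apply: leq_trans (max_card _) _; rewrite card_ord -ltnS.
Qed.

End Coefficients.

(** * Functions of full degree *)

Section TopDegree.
Variable R : realFieldType.
Variable n : nat.

Definition setind (U : {set 'rV['F_2]_n}) : boolfun n := [ffun x => (x \in U)%:R].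

Lemma avg_in (U : {set 'rV['F_2]_n}) :
  avg (fun x => (x \in U)%:R : R) = #|U|%:R / 2 ^+ n.
Proof. by rewrite /avg -natr_sum -big_mkcond /= sum1_card. Qed.

(* [1 / 4 + 2 ^- k.+1] is a lower bound for the product of the factors
   [1 - 2 ^- i], 1 <= i <= k, that is preserved by induction on k. *)
Lemma rho_subspace k (U : {set 'rV['F_2]_n}) :
    (forall x y, x \in U -> y \in U -> x + y \in U) -> 0 \in U ->
    (#|U| * 2 ^ k = 2 ^ n)%N ->
  (if k == 0%N then 1 else 1 / 4 + 2 ^- k.+1) <= rho R k (setind U).
Proof.
elim: k U => [|k IH] U UD U0 cU /=.
  have UT : U = setT.
    by apply/eqP; rewrite eqEcard subsetT cardsT card_F2V -cU expn0 muln1 leqnn.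
  rewrite -[X in X <= _](avg_const n); apply: le_avg => x.
  by rewrite ffunE UT inE nz1.
pose b : R := if k == 0%N then 1 else 1 / 4 + 2 ^- k.+1.
have ND (a x : 'rV_n) : x \in U -> (x + a \in U) = (a \in U).
  move=> xU; apply/idP/idP => [/(UD _ _ xU)|aU]; last exact: UD.
  by rewrite addrA addV2 add0r.
(* For [a] outside [U], the derivative of the indicator of [U] is the indicator of the span of [U]
   and [a], of codimension one less. *)
have rhoD a : (1 - (a \in U)%:R) * b <= rho R k (D a (setind U)).
  case: (boolP (a \in U)) => aU; first by rewrite subrr mul0r rho_ge0.
  rewrite subr0 mul1r.
  pose U' := U :|: [set x | x + a \in U].
  have -> : D a (setind U) = setind U'.
    apply/ffunP => x; rewrite !ffunE !inE; case: (boolP (x \in U)) => xU.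
      by rewrite ND // (negPf aU) orbF; exact: addr0.
    by exact: add0r.
  apply: IH => [x y|/=|].
  - rewrite !inE => /orP[] xU /orP[] yU.
    + by rewrite UD.
    + by apply/orP; right; rewrite -addrA; apply: UD.
    + by apply/orP; right; rewrite addrAC; apply: UD.
    + by have := UD _ _ xU yU; rewrite addrACA addV2 addr0 => ->.
  - by rewrite inE U0.
  have -> : #|U'| = (2 * #|U|)%N.
    rewrite cardsU (_ : U :&: _ = set0) ?cards0 ?subn0; last first.
      apply/setP => x; rewrite !inE; apply/negP => /andP[xU].
      by rewrite ND // (negPf aU).
    rewrite mul2n -addnn; congr (_ + _)%N.
    rewrite -[RHS](card_imset _ (addIr a)); apply: eq_card => x; rewrite inE.
    apply/idP/imsetP => [xU|[y yU ->]]; last by rewrite addVK.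
    by exists (x + a) => //; rewrite addVK.
  by rewrite -cU expnS mulnCA mulnA.
apply: le_trans (le_avg rhoD).
have -> : avg (fun a => (1 - (a \in U)%:R) * b) = (1 - 2 ^- k.+1) * b.
  rewrite [LHS](eq_avg (G := fun a => b * (1 - (a \in U)%:R))); last first.
    by move=> a; rewrite mulrC.
  rewrite avgZ avgB avg_const avg_in mulrC; congr ((1 - _) * _).
  have U00 : #|U|%:R != 0 :> R.
    by rewrite pnatr_eq0 -lt0n; apply/card_gt0P; exists 0.
  by rewrite -natrX -cU natrM natrX invfM mulVKf.
rewrite /b; case: k {IH b rhoD cU} => [|k] /=; first by rewrite !exprS expr0; lra.
(* The claim becomes (1 - y)(1/4 + y) >= 1/4 + y/2, which holds for 0 <= y <= 1/4. *)
set y : R := 2 ^- k.+2.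
have -> : 2 ^- k.+3 = y / 2 by rewrite /y exprS invfM mulrC.
have y0 : 0 <= y by rewrite invr_ge0 exprn_ge0.
have y4 : y <= 1 / 4.
  rewrite /y !exprS !invfM; have : (2 ^+ k)^-1 <= 1 :> R.
    by rewrite invf_le1 ?exprn_gt0 // exprn_ege1 //; lra.
  lra.
nra.
Qed.

Lemma coef_top_lowdeg (g : boolfun n) : mlpoly_of g setT = 0 -> lowdeg n g.
Proof.
move=> g0; case: n g g0 => [|m] g g0.
  rewrite /lowdeg -[g]mlpoly_ofK; apply/eqP/ffunP => x; rewrite !ffunE.
  rewrite big1 // => S _; rewrite (_ : S = setT) ?g0 ?mul0r //.
  by apply/setP => -[].
rewrite -deg_lowdeg; apply/bigmax_leqP => S; apply: contraNT; rewrite -ltnNge => mS.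
rewrite (_ : S = setT) ?g0 //; apply/eqP; rewrite eqEcard subsetT cardsT card_ord.
exact: mS.
Qed.

(** Both [g] and the indicator of a point have coefficient 1 at the full monomial. It cancels in
    their sum, which has degree less than [n] and so does not change [rho]. *)
Lemma rho_top (g : boolfun n) : ~~ lowdeg n g -> 1 / 4 <= rho R n g.
Proof.
move=> gn; have r1 : 1 / 4 <= rho R n (setind [set 0]).
  have c1 : (#|[set (0%R : 'rV['F_2]_n)]| * 2 ^ n = 2 ^ n)%N by rewrite cards1 mul1n.
  have := rho_subspace _ _ c1; rewrite set11 => /(_ _ isT) H.
  apply: le_trans (H _); last first.
    by move=> x y; rewrite !inE => /eqP -> /eqP ->; rewrite addr0.
  case: ifP => _; first by lra.
  by rewrite lerDl invr_ge0 exprn_ge0.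
have dn : ~~ lowdeg n (setind [set 0]).
  by apply: contraTN r1 => /rho_lowdeg ->; rewrite -ltNge; lra.
have nz_coef (h : boolfun n) : ~~ lowdeg n h -> mlpoly_of h setT = 1.
  by case: (F2P (mlpoly_of h setT)) => // /coef_top_lowdeg ->.
have low : lowdeg n (g + setind [set 0]).
  by apply: coef_top_lowdeg; rewrite mlpoly_ofD ffunE !nz_coef // addF2.
have gE : g = setind [set 0] + (g + setind [set 0]) by rewrite addrCA addbf2 addr0.
by rewrite gE rho_lowdegD.
Qed.

End TopDegree.

(** * Averaging the rejection probability over hyperplanes *)

Section Averaging.
Variable R : realFieldType.
Variable n : nat.
Implicit Types (g : boolfun n) (a b x l : 'rV['F_2]_n).

(* For l <> 0, [rhoK l k g] is the sum over the two hyperplanes of normal l of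
   the rejection probability of g restricted to the hyperplane. *)
Fixpoint rhoK l k g : R :=
  if k is k'.+1 then 2 * avg (fun a => (dot l a == 0)%:R * rhoK l k' (D a g))
  else 2 * avg (fun x => nz R (g x)).

Lemma rhoK0 k g : rhoK 0 k g = 2 ^+ k.+1 * rho R k g.
Proof.
elim: k g => [|k IH] g //; rewrite [2 ^+ k.+2]exprS -mulrA -avgZ /=.
by congr (_ * _); apply: eq_avg => a; rewrite dot0l eqxx mul1r IH.
Qed.

Lemma rhoK_zero l k : rhoK l k 0 = 0.
Proof.
elim: k => [|k IH] /=; rewrite -[RHS](mulr0 2); congr (_ * _).
  by rewrite -[RHS](avg_const n); apply: eq_avg => a; rewrite ffunE.
by rewrite -[RHS](avg_const n); apply: eq_avg => a; rewrite D0 IH mulr0.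
Qed.

Definition ann (L : {set 'rV['F_2]_n}) a := [set l in L | dot l a == 0].

(** Translation by [l0] exchanges the forms vanishing at [a] with the others. *)
Lemma card_half (L : {set 'rV['F_2]_n}) l0 a :
    (forall l l', l \in L -> l' \in L -> l + l' \in L) -> l0 \in L ->
  dot l0 a = 1 -> (#|L| = 2 * #|ann L a|)%N.
Proof.
move=> LD l0L l0a; rewrite -(cardsID [set l | dot l a == 0] L) mul2n -addnn.
have -> : L :&: [set l | dot l a == 0] = ann L a.
  by apply/setP => l; rewrite !inE.
congr (_ + _)%N; rewrite -[RHS](card_imset _ (addIr l0)); apply: eq_card => l.
rewrite !inE; apply/idP/imsetP => [/andP[la lL]|[l' ]].
  exists (l + l0); last by rewrite addVK.
  by rewrite inE LD //= dotDl l0a; case: (F2P (dot l a)) la => ->.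
rewrite inE => /andP[l'L /eqP l'a] ->; rewrite LD // dotDl l0a l'a.
by rewrite add0r.
Qed.

(* Directions orthogonal to L are periods of g. Restricting L to the
   annihilator of a adds a to these directions, and D_a g has period a. *)
Lemma sum_rhoK k g (L : {set 'rV['F_2]_n}) :
    (forall l l', l \in L -> l' \in L -> l + l' \in L) ->
    (forall b, (forall l, l \in L -> dot l b = 0) -> forall x, g (x + b) = g x) ->
  \sum_(l in L) rhoK l k g = 2 * #|L|%:R * rho R k g.
Proof.
elim: k g L => [|k IH] g L LD per /=.
  by rewrite sumr_const -mulr_natr; ring.
rewrite -mulr_sumr -avg_sum -mulrA; congr (_ * _); rewrite -avgZ; apply: eq_avg => a /=.
(* If no form of [L] is 1 at [a], then [a] is a period of [g] and both sides vanish. *)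
case: (pickP (fun l0 => (l0 \in L) && (dot l0 a == 1))) => [l0|all0]; last first.
  have -> : D a g = 0.
    apply/ffunP => x; rewrite !ffunE per ?addF2 // => l lL.
    by case: (F2P (dot l a)) => // la; have := all0 l; rewrite lL la eqxx.
  by rewrite rho0 mulr0 big1 // => l _; rewrite rhoK_zero mulr0.
move=> /andP[l0L /eqP l0a].
pose L' := ann L a.
have -> : \sum_(l in L) (dot l a == 0)%:R * rhoK l k (D a g) =
    \sum_(l in L') rhoK l k (D a g).
  rewrite big_mkcond [RHS]big_mkcond /=; apply: eq_bigr => l _.
  by rewrite inE; case: (l \in L) => //=; case: eqP; rewrite ?mul1r ?mul0r.
rewrite IH ?(card_half LD l0L l0a) ?natrM //.
  move=> l l'; rewrite !inE => /andP[lL /eqP la] /andP[l'L /eqP l'a].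
  by rewrite LD //= dotDl la l'a addr0.
move=> b L'b x; rewrite !ffunE.
(* On [L], the vector [b] acts either as 0 or as [a]. So [b] or [a + b] is a period of [g], and
   either way [b] is a period of [D a g]. *)
have Lb l : l \in L -> dot l b = dot l a * dot l0 b.
  move=> lL; case: (F2P (dot l a)) => la.
    by rewrite la mul0r L'b // inE lL la eqxx.
  rewrite la mul1r; apply: addF2_eq0; rewrite -dotDl L'b // inE LD //=.
  by rewrite dotDl la l0a addF2.
case: (F2P (dot l0 b)) => l0b.
  by rewrite addrAC !(per b) // => l lL; rewrite Lb // l0b mulr0.
have pab y : g (y + b) = g (y + a).
  rewrite -(per (a + b)) => [|l lL]; first by congr (g _); rewrite [a + b]addrC addrA addVK.
  by rewrite dotDr Lb // l0b mulr1 addF2.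
by rewrite pab addrAC pab addVK addrC.
Qed.

(** Taking all forms for [L] and removing the term [l = 0], given by [rhoK0], leaves the sum over
    all 2 (2^n - 1) affine hyperplanes. *)
Lemma sum_rhoK_neq0 k g :
  \sum_(l | l != 0) rhoK l k g = 2 * (2 ^+ n - 2 ^+ k) * rho R k g.
Proof.
have := @sum_rhoK k g setT.
rewrite (bigD1 0) ?inE //= rhoK0 cardsT card_F2V natrX => H.
rewrite (eq_bigl (fun l => (l \in setT) && (l != 0))); last by move=> l; rewrite inE.
rewrite mulrBr mulrBl -H; first by rewrite exprS; ring.
  by move=> l l' _ _; rewrite inE.
move=> b b0 x; suff -> : b = 0 by rewrite addr0.
by apply: dot_nondeg => l; rewrite dotC b0 ?inE.
Qed.

End Averaging.

(** * Restriction to hyperplanes and the induction step *)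

Section Hyperplanes.
Variable R : realFieldType.

(** A coordinate [j] with [l 0 j = 1] can be solved for: [pi] forgets it, and [psi c] recovers it
    from [dot l x = c]. *)
Lemma hyperplane_param n (l : 'rV['F_2]_n.+1) : l != 0 ->
  exists (psi : 'F_2 -> 'rV['F_2]_n -> 'rV['F_2]_n.+1)
         (pi : 'rV['F_2]_n.+1 -> 'rV['F_2]_n),
    [/\ affine pi, forall c y a, psi c (y + a) = psi c y + psi 0 a,
        forall c y, dot l (psi c y) = c, forall c y, pi (psi c y) = y
      & forall x, psi (dot l x) (pi x) = x].
Proof.
move=> /dot_neq0 [j lj].
pose s (y : 'rV['F_2]_n) := \sum_i l 0 (lift j i) * y 0 i.
pose psi c (y : 'rV['F_2]_n) : 'rV['F_2]_n.+1 :=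
  \row_i (if unlift j i is Some i' then y 0 i' else c + s y).
have sD y a : s (y + a) = s y + s a.
  by rewrite /s -big_split; apply: eq_bigr => i _; rewrite mxE mulrDr.
have psij c y : psi c y 0 j = c + s y by rewrite mxE unlift_none.
have psil c y i : psi c y 0 (lift j i) = y 0 i by rewrite mxE liftK.
have dotE (x : 'rV_n.+1) : dot l x = x 0 j + \sum_i l 0 (lift j i) * x 0 (lift j i).
  by rewrite /dot (bigD1_ord j) //= lj mul1r.
exists psi, (fun x => \row_i x 0 (lift j i)); split.
- by move=> x a; apply/rowP => i; rewrite !mxE addr0.
- move=> c y a; apply/rowP => i; rewrite !mxE; case: unliftP => [i' _|_].
    by rewrite mxE.
  by rewrite sD add0r addrA.
- move=> c y; rewrite dotE psij -addrA -[RHS]addr0; congr (_ + _).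
  under eq_bigr do rewrite psil.
  exact: addF2.
- by move=> c y; apply/rowP => i; rewrite mxE psil.
- move=> x; apply/rowP => i; rewrite mxE; case: unliftP => [i' ->|->]; first by rewrite mxE.
  rewrite dotE -addrA -[RHS]addr0; congr (_ + _); rewrite /s.
  by under [X in _ + X]eq_bigr do rewrite mxE; rewrite addF2.
Qed.

Lemma avg_hyperplane n (l : 'rV['F_2]_n.+1) c (psi : 'rV['F_2]_n -> 'rV['F_2]_n.+1)
    (pi : 'rV['F_2]_n.+1 -> 'rV['F_2]_n) (F : 'rV['F_2]_n.+1 -> R) :
    (forall y, dot l (psi y) = c) -> (forall y, pi (psi y) = y) ->
    (forall x, dot l x = c -> psi (pi x) = x) ->
  avg (fun y => F (psi y)) = 2 * avg (fun x => (dot l x == c)%:R * F x).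
Proof.
move=> dot_psi psiK piK; rewrite /avg exprS invfM [RHS]mulrCA.
have -> : 2 * ((2 : R)^-1 * (2 ^+ n)^-1) = (2 ^+ n)^-1.
  by rewrite mulVKf // pnatr_eq0.
congr (_ * _).
transitivity (\sum_(x | dot l x == c) F x).
  rewrite (reindex_onto psi pi) /=; last by move=> x /eqP; exact: piK.
  by apply: eq_bigl => y; rewrite dot_psi psiK !eqxx.
rewrite big_mkcond; apply: eq_bigr => x _.
by case: ifP; rewrite ?mul1r ?mul0r.
Qed.

(** Directions inside the hyperplanes are exactly the [psi 0 a], that is, those orthogonal to [l];
    they serve both cosets at once. *)
Lemma rhoK_split n (l : 'rV['F_2]_n.+1) (psi : 'F_2 -> 'rV['F_2]_n -> 'rV['F_2]_n.+1)
    (pi : 'rV['F_2]_n.+1 -> 'rV['F_2]_n) k (g : boolfun n.+1) :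
    (forall c y a, psi c (y + a) = psi c y + psi 0 a) ->
    (forall c y, dot l (psi c y) = c) -> (forall c y, pi (psi c y) = y) ->
    (forall x, psi (dot l x) (pi x) = x) ->
  rho R k ([ffun y => g (psi 0 y)] : boolfun n)
    + rho R k ([ffun y => g (psi 1 y)] : boolfun n) = rhoK R l k g.
Proof.
move=> psiD dot_psi psiK piK.
have avgE c (F : 'rV['F_2]_n.+1 -> R) :
  avg (fun y => F (psi c y)) = 2 * avg (fun x => (dot l x == c)%:R * F x).
  by apply: (avg_hyperplane F (dot_psi c) (psiK c)) => x <-.
elim: k g => [|k IH] g /=.
  have E c : avg (fun y => nz R (([ffun y => g (psi c y)] : boolfun n) y)) =
      2 * avg (fun x => (dot l x == c)%:R * nz R (g x)).
    by rewrite -avgE; apply: eq_avg => y; rewrite ffunE.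
  rewrite !E -mulrDr -avgD; congr (_ * _); apply: eq_avg => x.
  by case: (F2P (dot l x)) => ->; rewrite ?eqxx ?mul0r ?mul1r ?addr0 ?add0r.
have DE c a : D a [ffun y => g (psi c y)] =
    [ffun y => D (psi 0 a) g (psi c y)] :> boolfun n.
  by apply/ffunP => y; rewrite !ffunE psiD.
rewrite -avgE -avgD; apply: eq_avg => a; rewrite !DE.
exact: IH.
Qed.

(** Since [lowdeg k] is degree less than [k], this is distance from degree [d] when [k = d + 1].
    Stitching reaches distance at most four times this threshold, which is the range of
    [rho_near]. *)
Definition far k n (g : boolfun n) : bool :=
  [forall p : boolfun n, lowdeg k p ==> (2 ^- (k + 3) <= avg (fun x => nz R (g x + p x)))].

(** The pair holds the side of the hyperplane and a polynomial on the whole space. The average also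
    runs over the whole space, so 2^-(k+4) here means 2^-(k+3) relative to the hyperplane. *)
Definition close_on k n (g : boolfun n) (l : 'rV['F_2]_n) (cp : 'F_2 * boolfun n) : bool :=
  lowdeg k cp.2 &&
  (avg (fun x => (dot l x == cp.1)%:R * nz R (g x + cp.2 x)) < 2 ^- (k + 4)).

Definition close_forms k n (g : boolfun n) : {set 'rV['F_2]_n} :=
  [set l | [exists cp, close_on k g l cp]].

(** Each nonzero form outside [close_forms] has two far restrictions and contributes at least
    [2 * r] to [sum_rhoK_neq0]; the other terms are nonnegative. *)
Lemma rho_far_step k n (g : boolfun n.+1) (r : R) : 0 <= r ->
    (forall h : boolfun n, far k h -> r <= rho R k h) ->
  (2 ^+ n.+1 - 1 - #|close_forms k g|%:R) * r <= (2 ^+ n.+1 - 2 ^+ k) * rho R k g.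
Proof.
move=> r0 rho_r.
have rhoK_ge l : l != 0 -> l \notin close_forms k g -> 2 * r <= rhoK R l k g.
  move=> l0; have [psi [pi [piA psiD dot_psi psiK piK]]] := hyperplane_param l0.
  move=> lS; rewrite -(rhoK_split _ _ psiD dot_psi psiK piK).
  suff farc c : far k ([ffun y => g (psi c y)] : boolfun n).
    by have := rho_r _ (farc 0); have := rho_r _ (farc 1); lra.
  apply/forallP => p; apply/implyP => pk; rewrite leNgt; apply: contra lS => plt.
  rewrite inE; apply/existsP; exists (c, [ffun x => p (pi x)]).
  rewrite /close_on /= (lowdeg_comp piA pk) /=.
  have := avg_hyperplane (fun x => nz R (g x + ([ffun x => p (pi x)] : boolfun n.+1) x))
    (dot_psi c) (psiK c).
  have psipi x : dot l x = c -> psi c (pi x) = x by move=> <-.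
  move/(_ psipi).
  rewrite (eq_avg (G := fun y => nz R (([ffun y => g (psi c y)] : boolfun n) y + p y))).
    by move=> E; move: plt; rewrite E !exprD; lra.
  by move=> y; rewrite !ffunE psiK.
have := sum_rhoK_neq0 R k g.
rewrite (bigID (fun l => l \in close_forms k g)) /= => E.
have le1 : 0 <= \sum_(l | (l != 0) && (l \in close_forms k g)) rhoK R l k g.
  apply: sumr_ge0 => l _; elim: (k) g {rho_r rhoK_ge E} => [|j IH] h /=.
    by rewrite mulr_ge0 // avg_ge0 // => x; exact: nz_ge0.
  by rewrite mulr_ge0 // avg_ge0 // => x; rewrite mulr_ge0.
pose T := [set l in ~: close_forms k g | l != 0].
have le2 : \sum_(l in T) 2 * r <=
    \sum_(l | (l != 0) && (l \notin close_forms k g)) rhoK R l k g.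
  rewrite (eq_bigl (fun l => (l != 0) && (l \notin close_forms k g))).
    by apply: ler_sum => l /andP[]; exact: rhoK_ge.
  by move=> l; rewrite !inE andbC.
have cardT : (2 ^ n.+1 <= #|close_forms k g| + (1 + #|T|))%N.
  have <- : (#|[set (0%R : 'rV['F_2]_n.+1)]| + #|T| = 1 + #|T|)%N by rewrite cards1.
  rewrite -card_F2V -cardsT.
  apply: leq_trans (leq_add (leqnn _) (leq_card_setU _ _)).
  apply: leq_trans (leq_card_setU _ _); apply: subset_leq_card.
  by apply/subsetP => l _; rewrite !inE; case: eqP; case: [exists _, _].
move: cardT; rewrite -(ler_nat R) !natrD natrX => cardT.
rewrite sumr_const -mulr_natr in le2.
have : (2 ^+ n.+1 - 1 - #|close_forms k g|%:R) * r <= #|T|%:R * r.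
  by rewrite ler_wpM2r //; lra.
lra.
Qed.

End Hyperplanes.

(** * Stitching local polynomials into a global one *)

Section Stitching.
Variable R : realFieldType.
Variables (n k : nat).
Variables (g : boolfun n) (L : {set 'rV['F_2]_n}).
Variables (c : 'rV['F_2]_n -> 'F_2) (P : 'rV['F_2]_n -> boolfun n).
Hypothesis Pclose : forall l, l \in L -> close_on R k g l (c l, P l).

(** Multiplying by this affine form cuts a function down to a hyperplane at the cost of one
    degree. *)
Lemma form_ind (l x : 'rV['F_2]_n) (b : 'F_2) :
  nz R (dot l x + (b + 1)) = (dot l x == b)%:R.
Proof.
by case: (F2P (dot l x)) => ->; case: (F2P b) => ->;
  rewrite ?addr0 ?add0r ?addrA ?addF2 ?add0r ?nz0 ?nz1 ?eqxx.
Qed.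

(** The difference [P l + P l'] cut down to both hyperplanes has degree less than k + 2, so if
    nonzero its density is at least 2^-(k+1). The two closeness errors allow less than 2^-(k+3). *)
Lemma close_consistent l l' x : l \in L -> l' \in L ->
  dot l x = c l -> dot l' x = c l' -> P l x = P l' x.
Proof.
move=> lL l'L lx l'x; have /andP[/= Pk Pd] := Pclose lL.
have /andP[/= P'k P'd] := Pclose l'L.
have := lowdeg_mulform l (c l + 1) (lowdegD Pk P'k).
move=> /(lowdeg_mulform l' (c l' + 1)); set q := (X in lowdeg _ X) => qk.
have qE y : q y = (P l y + P l' y) * (dot l y + (c l + 1)) * (dot l' y + (c l' + 1)).
  by rewrite !ffunE.
have [q0|q0] := eqVneq q 0.
  have := qE x; rewrite q0 ffunE lx l'x !addrA !addF2 !add0r !mulr1.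
  by move=> /esym /addF2_eq0.
have := lowdeg_dist R qk q0.
have : avg (fun y => nz R (q y)) <= avg (fun y => (dot l y == c l)%:R * nz R (g y + P l y)
    + (dot l' y == c l')%:R * nz R (g y + P l' y)).
  apply: le_avg => y; rewrite qE !nzM !form_ind.
  have -> : P l y + P l' y = (g y + P l y) + (g y + P l' y).
    by rewrite addrACA addF2 add0r.
  have := nzD_le R (g y + P l y) (g y + P l' y).
  have := nz_ge0 R (g y + P l y + (g y + P l' y)).
  have := nz_ge0 R (g y + P l y); have := nz_ge0 R (g y + P l' y).
  by case: (_ == _); case: (_ == _); rewrite ?mul0r ?mulr0 ?mul1r ?mulr1; lra.
rewrite avgD; move: Pd P'd; rewrite exprD !exprS expr0 !invfM.
have : 0 < (2 ^+ k)^-1 :> R by rewrite invr_gt0 exprn_gt0.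
set z := (2 ^+ k)^-1 => *.
by have : 0 < 0 :> R; [lra | rewrite ltxx].
Qed.

Definition uncovered (A : {set 'rV['F_2]_n}) :=
  [set x | [forall l in A, dot l x != c l]].

Definition dual (A : {set 'rV['F_2]_n}) := [set e | [forall l in A, dot l e == 0]].

Lemma uncoveredP (A : {set 'rV['F_2]_n}) x :
  reflect (forall l, l \in A -> dot l x != c l) (x \in uncovered A).
Proof. by rewrite inE; apply: (iffP forall_inP). Qed.

Lemma dualP (A : {set 'rV['F_2]_n}) e :
  reflect (forall l, l \in A -> dot l e = 0) (e \in dual A).
Proof.
rewrite inE; apply: (iffP forall_inP) => H l lA; last by apply/eqP/H.
by apply/eqP/H.
Qed.

(** Translation by [e] preserves the forms of [A] and flips [l], so [uncovered (l |: A)] and its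
    translate are disjoint inside [uncovered A]. *)
Lemma card_uncoveredU (A : {set 'rV['F_2]_n}) l e : e \in dual A -> dot l e = 1 ->
  (#|uncovered (l |: A)| * 2 <= #|uncovered A|)%N.
Proof.
move=> /dualP eA le.
have sub : uncovered (l |: A) :|: (fun x => x + e) @: uncovered (l |: A) \subset uncovered A.
  apply/subsetP => x /setUP[/uncoveredP xA|/imsetP[y /uncoveredP yA ->]].
    by apply/uncoveredP => l' l'A; apply: xA; rewrite inE l'A orbT.
  apply/uncoveredP => l' l'A; rewrite dotDr eA // addr0.
  by apply: yA; rewrite inE l'A orbT.
apply: leq_trans (subset_leq_card sub).
rewrite cardsU (_ : _ :&: _ = set0) ?cards0 ?subn0.
  by rewrite card_imset ?muln2 ?addnn //; exact: addIr.
apply/setP => x; rewrite in_set0; apply/negP => /setIP[/uncoveredP xA].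
move=> /imsetP[y /uncoveredP yA xE].
have := xA l (setU11 _ _); have := yA l (setU11 _ _).
by rewrite xE dotDr le; case: (F2P (dot l y)) => ->; case: (F2P (c l)) => ->.
Qed.

(** A form [m] of the new span lies in the old span or in its translate by [l], according to its
    value at [e]. *)
Lemma card_dualdualU (A : {set 'rV['F_2]_n}) l e : e \in dual A -> dot l e = 1 ->
  (#|dual (dual (l |: A))| <= #|dual (dual A)| * 2)%N.
Proof.
move=> /dualP eA le.
have sub : dual (dual (l |: A)) \subset
    dual (dual A) :|: (fun x => x + l) @: dual (dual A).
  apply/subsetP => m /dualP mdd.
  have mdd' e' : e' \in dual A -> dot e' l = 0 -> dot e' m = 0.
    move=> /dualP e'A e'l; apply: mdd; apply/dualP => l' /setU1P[->|/e'A //].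
    by rewrite dotC.
  have e'e e' : e' \in dual A -> dot e' l = 1 -> dot e' m = dot e m.
    move=> /dualP e'A e'l; apply: addF2_eq0; rewrite -dotDl mdd' //.
      by apply/dualP => l' l'A; rewrite dotDr e'A // eA // addr0.
    by rewrite dotDl e'l dotC le addF2.
  case: (F2P (dot e m)) => em; apply/setUP; [left|right].
    apply/dualP => e' e'A; case: (F2P (dot e' l)) => e'l; first exact: mdd'.
    by rewrite e'e.
  apply/imsetP; exists (m + l); last by rewrite addVK.
  apply/dualP => e' e'A; rewrite dotDr; case: (F2P (dot e' l)) => e'l.
    by rewrite mdd' // e'l addr0.
  by rewrite e'e // em e'l addF2.
apply: leq_trans (subset_leq_card sub) _.
apply: leq_trans (leq_card_setU _ _) _.
by rewrite card_imset ?muln2 ?addnn //; exact: addIr.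
Qed.

(* Greedy choice of forms: as long as L is not contained in the span
   (bidual) of A, a form l outside of the span has a dual vector e, and the
   projection along e onto the hyperplane of l preserves the hyperplanes of A. *)
Lemma stitch_greedy t : (t <= k.+1)%N -> (2 ^ k < #|L|)%N ->
  exists (A : {set 'rV['F_2]_n}) (Q : boolfun n),
    [/\ A \subset L, lowdeg k Q,
        forall l x, l \in A -> dot l x = c l -> Q x = P l x,
        (#|uncovered A| * 2 ^ t <= 2 ^ n)%N & (#|dual (dual A)| <= 2 ^ t)%N].
Proof.
move=> tk Lk; elim: t tk => [|t IH] tk.
  exists set0, 0; split; rewrite ?sub0set ?lowdeg0 //.
  - by move=> l x; rewrite inE.
  - by rewrite expn0 muln1 -card_F2V max_card.
  suff /subset_leq_card : dual (dual set0) \subset [set (0%R : 'rV['F_2]_n)] by rewrite cards1.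
  apply/subsetP => m /dualP m0; rewrite inE; apply/eqP/dot_nondeg => e.
  by rewrite dotC; apply: m0; apply/dualP => l; rewrite inE.
have [A [Q [AL Qk QP cA cdA]]] := IH (ltnW tk).
have [l lL ldA] : exists2 l, l \in L & l \notin dual (dual A).
  apply/subsetPn; apply: contraL Lk => /subset_leq_card Ld; rewrite -leqNgt.
  by apply: leq_trans Ld (leq_trans cdA _); rewrite leq_exp2l.
have [e eA le] : exists2 e, e \in dual A & dot l e = 1.
  move: ldA; rewrite inE negb_forall_in => /exists_inP [e eA el].
  by exists e => //; rewrite dotC; case: (F2P (dot e l)) el => ->.
pose phi x := x + (dot l x + c l) *: e.
have phiA : affine phi.
  move=> x a; rewrite /phi dotDr dot0r; apply/rowP => i; rewrite !mxE.
  have c0 : (c l + c l) * e 0 i = 0 by rewrite addF2 mul0r.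
  by rewrite -[LHS]addr0 -[X in _ + X = _]c0; ring.
have /andP[/= Pk _] := Pclose lL.
(* On the hyperplane of [l], [phi] is the identity and the sum is [P l]. On the hyperplane of an
   older form [l'], [phi] lands in both hyperplanes, where [Q], [P l'] and [P l] agree, so the
   correction vanishes. *)
exists (l |: A), (Q + [ffun x => (Q + P l) (phi x)]); split.
- by rewrite subUset sub1set lL.
- by rewrite lowdegD // lowdeg_comp // lowdegD.
- move=> l' x /setU1P[->|l'A] lx; rewrite !ffunE.
    rewrite /phi lx addF2 scale0r addr0 addrA addF2 add0r //.
  have l'phi : dot l' (phi x) = c l'.
    by rewrite dotDr dotZr (dualP _ _ eA) // mulr0 addr0.
  have lphi : dot l (phi x) = c l.
    by rewrite dotDr dotZr le mulr1 addrA addF2 add0r.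
  rewrite (QP _ _ l'A lx) (QP _ _ l'A l'phi).
  rewrite (close_consistent (subsetP AL _ l'A) lL l'phi lphi).
  by rewrite addF2 addr0.
- apply: leq_trans cA; rewrite expnS mulnA leq_mul2r.
  by rewrite (card_uncoveredU eA le) orbT.
apply: leq_trans (card_dualdualU eA le) _.
by rewrite expnS mulnC leq_mul2l cdA orbT.
Qed.

(** After k + 1 greedy choices at most a fraction 2^-(k+1) is uncovered. For any [l], [Q + P l] cut
    down to its hyperplane vanishes on covered points and has degree less than k + 1, so it is zero
    by minimum distance 2^-k. *)
Lemma stitch : (2 ^ k < #|L|)%N ->
  exists2 Q : boolfun n, lowdeg k Q &
    forall l x, l \in L -> dot l x = c l -> Q x = P l x.
Proof.
move=> /(stitch_greedy (leqnn _)) [A [Q [AL Qk QP cA _]]].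
exists Q => // l x lL lx; have /andP[/= Pk _] := Pclose lL.
have := lowdeg_mulform l (c l + 1) (lowdegD Qk Pk).
set q := (X in lowdeg _ X) => qk.
have qE y : q y = (Q y + P l y) * (dot l y + (c l + 1)) by rewrite !ffunE.
have [q0|q0] := eqVneq q 0.
  have := qE x; rewrite q0 ffunE lx !addrA !addF2 !add0r !mulr1.
  by move=> /esym /addF2_eq0.
have := lowdeg_dist R qk q0.
have : avg (fun y => nz R (q y)) <= avg (fun y => (y \in uncovered A)%:R).
  apply: le_avg => y; rewrite qE nzM form_ind.
  case: (boolP (y \in uncovered A)) => yA.
    by have := nz_le1 R (Q y + P l y); have := nz_ge0 R (Q y + P l y);
      case: (_ == _); rewrite ?mulr0 ?mulr1 /=; lra.
  case: eqP => ly; rewrite ?mulr0 // mulr1.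
  move: yA; rewrite inE negb_forall_in => /exists_inP [l' l'A].
  rewrite negbK => /eqP l'y; rewrite (QP _ _ l'A l'y).
  by rewrite (@close_consistent l' l) ?addF2 //; exact: (subsetP AL).
rewrite avg_in; move: cA; rewrite -(ler_nat R) natrM !natrX exprS => cA.
have n0 : 0 < 2 ^+ n :> R by rewrite exprn_gt0.
have k0 : 0 < 2 ^+ k :> R by rewrite exprn_gt0.
have : #|uncovered A|%:R / 2 ^+ n <= (2 ^+ k)^-1 / 2 :> R.
  rewrite ler_pdivrMr // -mulrA -ler_pdivrMl ?invr_gt0 // invrK.
  by move: cA; lra.
have : 0 < (2 ^+ k)^-1 :> R by rewrite invr_gt0.
move=> *.
by have : 0 < 0 :> R; [lra | rewrite ltxx].
Qed.

End Stitching.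

(** * Even covering of the space by hyperplanes *)

Section SecondMoment.
Variable R : realFieldType.
Variable n : nat.

(* Distinct forms are pairwise independent, so few points lie on fewer than
   about half of the hyperplanes. *)
Lemma hyperplane_cover (L : {set 'rV['F_2]_n}) (c : 'rV['F_2]_n -> 'F_2)
    (B : 'rV['F_2]_n -> bool) :
  #|L|%:R ^+ 2 * avg (fun x => (B x)%:R) <=
    4 * #|L|%:R * (\sum_(l in L) avg (fun x => (dot l x == c l)%:R * (B x)%:R))
    + #|L|%:R :> R.
Proof.
pose s x := \sum_(l in L) chi R (dot l x + c l).
(* Cross terms vanish because [l + l'] is a nonzero form when [l] and [l'] differ. *)
have sE : avg (fun x => s x ^+ 2) = #|L|%:R.
  have -> : avg (fun x => s x ^+ 2) =
      avg (fun x => \sum_(l in L) \sum_(l' in L) chi R (c l + c l') * chi R (dot (l + l') x)).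
    apply: eq_avg => x; rewrite expr2 mulr_suml; apply: eq_bigr => l _.
    rewrite mulr_sumr; apply: eq_bigr => l' _.
    by rewrite dotDl !chiD; ring.
  rewrite avg_sum -sumr_const; apply: eq_bigr => l lL.
  rewrite avg_sum (bigD1 l) //= big1 => [|l' /andP[_ l'l]].
    by rewrite avgZ avg_chi addV2 eqxx addF2 /chi nz0 mulr0 subr0 mul1r addr0.
  rewrite avgZ avg_chi; case: eqP => [E|]; last by rewrite mulr0.
  case/eqP: l'l; move/eqP: E; rewrite addr_eq0 => /eqP ->.
  by rewrite -[RHS]add0r -(addV2 l') addrK.
rewrite -[X in _ <= _ + X]sE -avgZ -avg_sum -avgZ -avgD.
apply: le_avg => x; set K : R := #|L|%:R.
have -> : \sum_(l in L) (dot l x == c l)%:R * (B x)%:R = (B x)%:R * ((s x + K) / 2).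
  have -> : s x + K = \sum_(l in L) 2 * (dot l x == c l)%:R.
    rewrite /K -sumr_const -big_split; apply: eq_bigr => l _ /=.
    by case: (F2P (dot l x)) => ->; case: (F2P (c l)) => ->;
      rewrite ?addr0 ?add0r ?addF2 /chi ?nz0 ?nz1 ?eqxx /=; lra.
  rewrite -mulr_sumr [_ / _]mulrC mulKf ?pnatr_eq0 // mulr_sumr.
  by apply: eq_bigr => l _; rewrite mulrC.
case: (B x); rewrite ?mulr1 ?mul1r ?mulr0 ?mul0r; last first.
  by rewrite mulr0 add0r sqr_ge0.
(* Where [B] holds, the inequality K^2 <= 2 K (s + K) + s^2 is exactly (s + K)^2 >= 0. *)
by have := sqr_ge0 (s x + K); nra.
Qed.

End SecondMoment.

(** * A constant lower bound for far functions *)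

Section FarFunctions.
Variable R : realFieldType.

Lemma rho_near k n (g Q : boolfun n) : lowdeg k Q ->
    avg (fun x => nz R (g x + Q x)) <= 2 ^- k.+1 ->
  2 ^+ k * avg (fun x => nz R (g x + Q x)) / 2 <= rho R k g.
Proof.
move=> Qk; rewrite -(rho_lowdegD R g Qk).
rewrite (_ : avg _ = avg (fun x => nz R ((g + Q) x))); last first.
  by apply: eq_avg => x; rewrite ffunE.
set dl := avg _ => dlk; apply: le_trans (rho_ge k (erefl dl)).
have k0 : 0 < 2 ^+ k :> R by rewrite exprn_gt0.
have d0 : 0 <= dl by apply: avg_ge0 => x; exact: nz_ge0.
have : 2 ^+ k * dl <= 1 / 2.
  by rewrite -ler_pdivlMl // mul1r -invfM -exprSr.
have : 0 <= 2 ^+ k * dl by rewrite mulr_ge0 // ltW.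
nra.
Qed.

Lemma avg_nz_card n (q : boolfun n) :
  avg (fun x => nz R (q x)) = #|[set x | q x != 0]|%:R / 2 ^+ n.
Proof. by rewrite -avg_in; apply: eq_avg => x; rewrite inE. Qed.

Lemma avg_nz_small m n (q : boolfun n) : (n <= m)%N ->
  avg (fun x => nz R (q x)) < 2 ^- m -> avg (fun x => nz R (q x)) = 0.
Proof.
move=> nm; rewrite avg_nz_card ltr_pdivrMr ?exprn_gt0 //.
case: #|_| => [|c] clt; first by rewrite mul0r.
have : 1 <= c.+1%:R :> R by rewrite ler1n.
have : 2 ^- m * 2 ^+ n <= 1 :> R.
  by rewrite mulrC ler_pdivrMr ?exprn_gt0 // mul1r ler_eXn2l //; lra.
lra.
Qed.

(** [hyperplane_cover] is applied to the points where [g] and [Q] differ, using that [Q] is the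
    local polynomial on each hyperplane. For n <= k + 4 a local error below 2^-(k+4) must be zero,
    as densities are multiples of 2^-n. *)
Lemma stitch_close k n (g : boolfun n) : let K : R := #|close_forms R k g|%:R in
  (2 ^ k < #|close_forms R k g|)%N ->
  exists Q : boolfun n, [/\ lowdeg k Q,
    K * avg (fun x => nz R (g x + Q x)) <= 4 * K * 2 ^- (k + 4) + 1 &
    (n <= k + 4)%N -> K * avg (fun x => nz R (g x + Q x)) <= 1].
Proof.
move=> K Kk.
(* The default is only taken outside [close_forms]. *)
pose cP l := odflt (0, 0) [pick cp | close_on R k g l cp].
have cPP l : l \in close_forms R k g -> close_on R k g l ((cP l).1, (cP l).2).
  rewrite inE /cP; case: pickP => [cp|none] /=; first by rewrite -surjective_pairing.
  by case/existsP => cp; rewrite none.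
have [Q Qk QP] := stitch cPP Kk.
have K0 : 0 < K by rewrite ltr0n; apply: leq_ltn_trans Kk.
pose e l := avg (fun x => (dot l x == (cP l).1)%:R * nz R (g x + Q x)).
have eE l : l \in close_forms R k g ->
    e l = avg (fun x => (dot l x == (cP l).1)%:R * nz R (g x + (cP l).2 x)).
  move=> lS; apply: eq_avg => x; case: eqP; rewrite ?mul0r // => lx.
  by rewrite (QP l).
have cover : K * avg (fun x => nz R (g x + Q x)) <=
    4 * \sum_(l in close_forms R k g) e l + 1.
  have := hyperplane_cover R (close_forms R k g) (fun l => (cP l).1)
    (fun x => g x + Q x != 0).
  rewrite -/K expr2 -/(nz _ _) -/(e _) => H.
  rewrite -(ler_pM2l K0) mulrA; apply: le_trans H _.
  by rewrite mulrDr mulr1 mulrA [K * 4]mulrC.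
exists Q; split=> // [|nk].
  apply: le_trans cover _; rewrite lerD2r -mulrA ler_wpM2l // /K mulr_natl -sumr_const.
  by apply: ler_sum => l lS; rewrite eE //; have /andP[_ /ltW] := cPP _ lS.
apply: le_trans cover _; rewrite big1 ?mulr0 ?add0r // => l lS.
rewrite eE //; have /andP[_] := cPP _ lS => /=.
have -> : avg (fun x => (dot l x == (cP l).1)%:R * nz R (g x + (cP l).2 x)) =
    avg (fun x => nz R (([ffun x => (dot l x + ((cP l).1 + 1)) * (g x + (cP l).2 x)]
      : boolfun n) x)).
  by apply: eq_avg => x; rewrite ffunE nzM form_ind.
exact: avg_nz_small.
Qed.

Lemma rho_far_near k n (g Q : boolfun n) : far R k g -> lowdeg k Q ->
  avg (fun x => nz R (g x + Q x)) <= 2 ^- k.+1 -> 1 / 16 <= rho R k g.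
Proof.
move=> /forallP /(_ Q) + Qk; rewrite Qk /= => fQ /(rho_near Qk).
apply: le_trans; move: fQ; rewrite exprD invfM => fQ.
have k0 : 0 < 2 ^+ k :> R by rewrite exprn_gt0.
have := ler_wpM2l (ltW k0) fQ; rewrite mulrA mulfV ?gt_eqF // !exprS expr0.
lra.
Qed.

(** With at least 2^(k+2) close forms, both terms of [stitch_close] divided by their number are at
    most 2^-(k+2), and they add up to 2^-(k+1). *)
Lemma rho_far_many k n (g : boolfun n) : far R k g ->
  (2 ^ (k + 2) <= #|close_forms R k g|)%N -> 1 / 16 <= rho R k g.
Proof.
move=> gfar Kk.
have lt_k : (2 ^ k < #|close_forms R k g|)%N.
  by apply: leq_trans Kk; rewrite ltn_exp2l //; lia.
have [Q [Qk Qd _]] := stitch_close lt_k; apply: (rho_far_near gfar Qk).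
move: Qd; set K : R := #|_|%:R; set a := avg _ => Qd.
have k0 : 0 < 2 ^+ k :> R by rewrite exprn_gt0.
have KR : 4 * 2 ^+ k <= K.
  by move: Kk; rewrite -(ler_nat R) natrX exprD mulrC -natrX.
have K0 : 0 < K by lra.
rewrite -(ler_pM2l K0); apply: le_trans Qd _.
move: KR; rewrite exprD !exprS expr0 !invfM => KR.
set z := (2 ^+ k)^-1; have zk : 2 ^+ k * z = 1 by rewrite mulfV // gt_eqF.
have z0 : 0 < z by rewrite invr_gt0.
have : 4 <= K * z by rewrite -ler_pdivrMr // invrK.
lra.
Qed.

(** When more than half of all forms are close, [Q] differs from [g] in fewer than two points, so
    the distance is at most 2^-n <= 2^-(k+1). *)
Lemma rho_far_many_small k n (g : boolfun n) : far R k g -> (k < n <= k + 3)%N ->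
  (2 ^ n < 2 * #|close_forms R k g|)%N -> 1 / 16 <= rho R k g.
Proof.
move=> gfar /andP[kn nk] Kn.
have lt_k : (2 ^ k < #|close_forms R k g|)%N.
  rewrite -(ltn_pmul2l (isT : 0 < 2)%N); apply: leq_ltn_trans Kn.
  by rewrite -expnS leq_exp2l.
have [Q [Qk _ Qd]] := stitch_close lt_k; apply: (rho_far_near gfar Qk).
have {}Qd := Qd (leq_trans nk (leq_add (leqnn k) (isT : 3 <= 4)%N)).
move: Qd; rewrite (_ : avg _ = avg (fun x => nz R ((g + Q) x))); last first.
  by apply: eq_avg => x; rewrite ffunE.
rewrite avg_nz_card; set c := #|[set x | _]|; set K : R := #|_|%:R => Qd.
have n0 : 0 < 2 ^+ n :> R by rewrite exprn_gt0.
have Kn' : 2 ^+ n < 2 * K by rewrite -natrX -natrM ltr_nat.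
have c1 : (c <= 1)%N.
  rewrite leqNgt; apply/negP => c2.
  have c2' : 2 <= c%:R :> R by rewrite ler_nat.
  move: Qd; rewrite mulrA ler_pdivrMr // mul1r; nra.
apply: (@le_trans _ _ (1 / 2 ^+ n)).
  by rewrite ler_wpM2r ?invr_ge0 ?(ltW n0) // lern1.
by rewrite mul1r lef_pV2 ?posrE ?exprn_gt0 // ler_eXn2l //; lra.
Qed.

Lemma far_notlow k n (g : boolfun n) : far R k g -> ~~ lowdeg k g.
Proof.
move=> /forallP /(_ g); apply: contraTN => ->; rewrite implyTb -ltNge.
rewrite (_ : avg _ = 0); first by rewrite invr_gt0 exprn_gt0.
by rewrite -[RHS](avg_const n); apply: eq_avg => x; rewrite addF2.
Qed.

(** Starts from 1/4 at n = k, by [rho_top]. Each further dimension costs at most a factor 4, since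
    at least half of the forms are not close or else the bound 1/16 applies. *)
Lemma rho_far_small k n (g : boolfun n) : (0 < k)%N -> (n <= k + 3)%N ->
  far R k g -> 4 ^- (n.+1 - k) <= rho R k g.
Proof.
move=> k0; elim: n g => [|n IH] g nk gfar.
  by have := far_notlow gfar; rewrite lowdeg_dim.
have [kn|nk'|kE] := ltngtP k n.+1.
- have [Kn|Kn] := ltnP (2 ^ n.+1) (2 * #|close_forms R k g|).
    have := rho_far_many_small gfar; rewrite kn nk => /(_ isT Kn); apply: le_trans.
    rewrite subSn; last exact: ltnW.
    rewrite subSn // !exprS.
    have : (4 ^+ (n - k))^-1 <= 1 :> R.
      by rewrite invf_le1 ?exprn_gt0 // exprn_ege1 //; lra.
    by rewrite !invfM; lra.
  pose r : R := 4 ^- (n.+1 - k).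
  have r0 : 0 < r by rewrite invr_gt0 exprn_gt0.
  have IH' (h : boolfun n) : far R k h -> r <= rho R k h by apply: IH; exact: ltnW.
  have := rho_far_step g (ltW r0) IH'.
  have -> : 4 ^- (n.+2 - k) = r / 4 by rewrite /r subSn 1?ltnW // exprS invfM mulrC.
  have n1 : 2 <= 2 ^+ n :> R.
    by rewrite -[X in X <= _]expr1 ler_eXn2l; [exact: leq_trans k0 _ | lra].
  move: Kn; rewrite -(ler_nat R) natrM natrX exprS; set K : R := #|_|%:R => Kn.
  have rg := rho_ge0 R k g; have k2 : 0 < 2 ^+ k :> R by rewrite exprn_gt0.
  move=> H; have : (2 * 2 ^+ n) * (r / 4) <= (2 * 2 ^+ n) * rho R k g by nra.
  by rewrite ler_pM2l //; lra.
- by have := far_notlow gfar; rewrite lowdeg_dim.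
by subst k; rewrite subSn // subnn expr1 -[_^-1]mul1r rho_top // far_notlow.
Qed.

(** The base n = k + 3 gives 4^-4 = 2/512. The correction 2^(k+3) / 2^n halves at every step and
    thereby pays for the close hyperplanes, so the bound never falls below 1/512. *)
Lemma rho_far_large k n (g : boolfun n) : (0 < k)%N -> (k + 3 <= n)%N ->
  far R k g -> 1 / 512 * (1 + 2 ^+ (k + 3) / 2 ^+ n) <= rho R k g.
Proof.
move=> k0; elim: n g => [|n IH] g; first by rewrite addnS.
rewrite leq_eqVlt => /predU1P[kE|kn] gfar.
  have := rho_far_small k0 (eq_leq (esym kE)) gfar.
  rewrite kE divff ?expf_neq0 ?pnatr_eq0 //; apply: le_trans.
  have -> : (n.+2 - k = 4)%N by lia.
  by rewrite !exprS expr0; lra.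
have [Kk|Kk] := leqP (2 ^ (k + 2)) #|close_forms R k g|.
  apply: le_trans (rho_far_many gfar Kk).
  have : 2 ^+ (k + 3) / 2 ^+ n.+1 <= 1 :> R.
    by rewrite ler_pdivrMr ?exprn_gt0 // mul1r ler_eXn2l; [exact: ltnW | lra].
  lra.
pose y : R := 2 ^+ (k + 2) / 2 ^+ n.+1.
have n0 : 0 < 2 ^+ n.+1 :> R by rewrite exprn_gt0.
have y0 : 0 < y by rewrite divr_gt0 ?exprn_gt0.
have y4 : y <= 1 / 4.
  have : 2 ^+ (k + 2) * 2 ^+ 2 <= 2 ^+ n.+1 :> R.
    by rewrite -exprD ler_eXn2l; [lia | lra].
  rewrite /y ler_pdivrMr // expr2.
  by move: (2 ^+ (k + 2)) (2 ^+ n.+1) => X N; lra.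
have yE : 2 ^+ (k + 3) / 2 ^+ n.+1 = 2 * y by rewrite /y addnS exprS mulrA.
have yE' : 2 ^+ (k + 3) / 2 ^+ n = 4 * y.
  by rewrite /y addnS !exprS; field; rewrite expf_neq0 // pnatr_eq0.
pose r : R := 1 / 512 * (1 + 4 * y).
have r0 : 0 < r by rewrite /r; lra.
have IH' (h : boolfun n) : far R k h -> r <= rho R k h.
  by rewrite /r -yE'; apply: IH.
have := rho_far_step g (ltW r0) IH'.
have Kk' : #|close_forms R k g|%:R + 1 <= y * 2 ^+ n.+1.
  rewrite /y divfK ?gt_eqF // -natrX natr1 ler_nat //.
have rg := rho_ge0 R k g; have k2 : 0 < 2 ^+ k :> R by rewrite exprn_gt0.
set N : R := 2 ^+ n.+1 in n0 Kk' *; set K : R := #|_|%:R in Kk' *.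
move=> H; rewrite yE -(ler_pM2l n0).
have NK : N * (1 - y) <= N - 1 - K by lra.
have := ler_wpM2r (ltW r0) NK => /le_trans /(_ H) {}H.
(* (1 - y)(1 + 4 y) >= 1 + 2 y for 0 <= y <= 1/4. *)
have yr : 1 / 512 * (1 + 2 * y) <= (1 - y) * r.
  rewrite /r; have : 0 <= y * (1 / 4 - y) by rewrite mulr_ge0 ?subr_ge0 // ltW.
  lra.
have := ler_wpM2l (ltW n0) yr; rewrite [N * ((1 - y) * r)]mulrA => /le_trans; apply.
apply: le_trans H _; rewrite ler_wpM2r //; lra.
Qed.

Lemma rho_far k n (g : boolfun n) : (0 < k)%N -> far R k g -> 1 / 512 <= rho R k g.
Proof.
move=> k0 gfar; have [nk|kn] := leqP n (k + 3).
  apply: le_trans (rho_far_small k0 nk gfar).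
  apply: (@le_trans _ _ (4 ^- 4)); first by rewrite !exprS expr0; lra.
  by rewrite lef_pV2 ?posrE ?exprn_gt0 // ler_eXn2l; [lia | lra].
apply: le_trans (rho_far_large k0 (ltnW kn) gfar).
have : 0 < 2 ^+ (k + 3) / 2 ^+ n :> R by rewrite divr_gt0 ?exprn_gt0.
lra.
Qed.

End FarFunctions.

(** * The Gowers test, its norm and the distance to low degree *)

Section GowersTest.
Variable R : realType.
Variable n : nat.

Definition parsum k (f : boolfun n) (a : 'I_k -> 'rV['F_2]_n) x : 'F_2 :=
  \sum_(J : {set 'I_k}) f (x + \sum_(j in J) a j).

(** Subsets with and without [ord0] are paired; each pair contributes one value of the derivative
    along [a ord0]. *)
Lemma parsumS k f (a : 'I_k.+1 -> 'rV['F_2]_n) x :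
  parsum f a x = parsum (D (a ord0) f) (fun i => a (lift ord0 i)) x.
Proof.
pose h := lift (@ord0 k); have hinj : injective h := @lift_inj _ ord0.
have h0 (J : {set 'I_k}) : ord0 \notin h @: J.
  by apply/imsetP => -[i _] /eqP; rewrite (negPf (neq_lift ord0 i)).
have hK (J : {set 'I_k}) : h @^-1: (h @: J) = J.
  by apply/setP => i; rewrite inE mem_imset.
have hK' (J : {set 'I_k.+1}) : h @: (h @^-1: J) = J :\ ord0.
  apply/setP => i; rewrite !inE; apply/imsetP/andP => [[i' + ->]|[i0 iJ]].
    by rewrite inE eq_sym neq_lift.
  case: (unliftP ord0 i) => [i' iE|iE]; last by rewrite iE eqxx in i0.
  by exists i' => //; rewrite inE /h -iE.
rewrite /parsum (bigID (fun J : {set 'I_k.+1} => ord0 \in J)) /= addrC.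
rewrite (reindex_onto (fun J : {set 'I_k} => h @: J) (fun J => h @^-1: J)) /=; last first.
  by move=> J J0; rewrite hK'; apply/setDidPl; rewrite disjoint_sym disjoints1.
rewrite [X in _ + X](reindex_onto (fun J : {set 'I_k} => ord0 |: h @: J)
    (fun J => h @^-1: J)) /=; last first.
  by move=> J J0; rewrite hK' setD1K.
rewrite (eq_bigl xpredT) => [|J]; last by rewrite hK h0 eqxx.
rewrite [X in _ + X](eq_bigl xpredT) => [|J]; last first.
  by rewrite setU11 /=; apply/eqP/setP => i; rewrite !inE mem_imset.
rewrite -big_split; apply: eq_bigr => J _ /=; rewrite ffunE.
rewrite big_setU1 //= big_imset /=; last by move=> i j _ _; exact: hinj.
by rewrite [a ord0 + _]addrC addrA.
Qed.

Lemma sum_ffunS k (T : finType) (G : {ffun 'I_k.+1 -> T} -> R) :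
  \sum_a G a = \sum_b \sum_(a : {ffun 'I_k -> T})
    G [ffun i => if unlift ord0 i is Some j then a j else b].
Proof.
rewrite pair_big /=.
pose u (a : {ffun 'I_k.+1 -> T}) := (a ord0, [ffun j => a (lift ord0 j)] : {ffun 'I_k -> T}).
rewrite (reindex_onto (fun p : T * {ffun 'I_k -> T} =>
  [ffun i => if unlift ord0 i is Some j then p.2 j else p.1]) u) /=.
  apply: eq_bigl => -[b a]; rewrite /u xpair_eqE; apply/andP; split; apply/eqP.
    by rewrite ffunE unlift_none.
  by apply/ffunP => j; rewrite !ffunE liftK.
by move=> a _; apply/ffunP => i; rewrite ffunE; case: unliftP => [j|] ->; rewrite ?ffunE.
Qed.

Lemma rhoE k (f : boolfun n) :
  rho R k f = (\sum_(a : {ffun 'I_k -> 'rV['F_2]_n}) avg (fun x => nz R (parsum f a x)))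
    / (2 ^+ n) ^+ k.
Proof.
elim: k f => [|k IH] f /=.
  rewrite expr0 divr1 (bigD1 [ffun _ => 0]) //= [X in _ + X]big1 ?addr0 => [|a /eqP[]].
    apply: eq_avg => x; rewrite /parsum (bigD1 set0) //= big_set0 addr0.
    rewrite big1 ?addr0 // => J /eqP[]; by apply/setP => -[].
  by apply/ffunP => -[].
rewrite sum_ffunS exprS invfM mulrA /avg !mulr_suml; apply: eq_bigr => b _.
rewrite IH [RHS]mulrAC; congr (_ / _ / _); apply: eq_bigr => a _.
apply: eq_avg => x; congr (nz R _); rewrite [RHS]parsumS ffunE unlift_none.
by apply: eq_bigr => J _; congr (D b f (_ + _)); apply: eq_bigr => j _; rewrite ffunE liftK.
Qed.

Lemma prob_reject k (f : boolfun n) :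
  prob R (predC (@gowers_accepts k n f)) = rho R k f.
Proof.
rewrite rhoE /prob card_prod card_ffun card_ord card_F2V natrM !natrX.
have -> : #|predC (@gowers_accepts k n f)|%:R =
    \sum_(a : {ffun 'I_k -> 'rV['F_2]_n}) \sum_x nz R (parsum f a x).
  rewrite exchange_big pair_big /= -sum1_card natr_sum big_mkcond /=.
  by apply: eq_bigr => xa _; rewrite inE /gowers_accepts /nz /parsum; case: (_ == 0).
by rewrite /avg -mulr_suml invfM mulrA.
Qed.

Lemma gowers_normE k (f : boolfun n) :
  gowers_norm R k f = (1 - 2 * rho R k f) `^ (2 ^+ k)^-1.
Proof.
rewrite /gowers_norm prob_reject; congr (_ `^ _).
have : prob R (@gowers_accepts k n f) + prob R (predC (@gowers_accepts k n f)) = 1.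
  rewrite /prob -mulrDl -natrD cardC divff // pnatr_eq0 -lt0n.
  by apply/card_gt0P; exists (0, [ffun=> 0]).
by rewrite prob_reject; lra.
Qed.

Lemma gowers_norm_ge0 k (f : boolfun n) : 0 <= gowers_norm R k f.
Proof. exact: powR_ge0. Qed.

(** The root can be undone because [rho_bias_ge0] makes its base nonnegative; this is why the order
    is [k.+1]. *)
Lemma gowers_normX k (f : boolfun n) :
  gowers_norm R k.+1 f ^+ (2 ^ k.+1) = 1 - 2 * rho R k.+1 f.
Proof.
have r0 := rho_bias_ge0 R k f.
rewrite gowers_normE -powR_mulrn ?powR_ge0 // -powRrM natrX mulVf ?powRr1 //.
by rewrite expf_neq0 // pnatr_eq0.
Qed.

Lemma distE (f g : boolfun n) : dist R f g = avg (fun x => nz R (f x + g x)).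
Proof.
rewrite (eq_avg (G := fun x => nz R ((f + g) x))); last by move=> x; rewrite ffunE.
rewrite avg_nz_card /dist /prob card_F2V natrX; congr (_%:R / _).
apply: eq_card => x; rewrite !inE ffunE; congr (~~ _).
by apply/eqP/eqP => [->|/addF2_eq0 //]; rewrite addF2.
Qed.

Lemma rho_le_delta d (f : boolfun n) : rho R d.+1 f <= 2 ^+ d.+1 * delta R d f.
Proof.
have [g gd ->] := delta_attained R d f; rewrite distE.
rewrite -(@rho_lowdegD R n d.+1 f g) -?deg_lowdeg //.
apply: le_trans (rho_le _ _ _) _; rewrite ler_wpM2l ?exprn_ge0 //.
by apply: le_avg => x; rewrite ffunE.
Qed.

(** By [rho_far], [f] is not far, so some [Q] is within 2^-(d+4), inside the range of [rho_near],
    whose factor 2^(d+1) / 2 is 2^d. *)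
Lemma delta_le_rho d (f : boolfun n) : rho R d.+1 f < 1 / 512 ->
  2 ^+ d * delta R d f <= rho R d.+1 f.
Proof.
move=> rlt; have : ~~ far R d.+1 f.
  by apply: contraTN rlt => ffar; rewrite -leNgt rho_far.
rewrite negb_forall => /existsP [Q]; rewrite negb_imply -ltNge => /andP[Qd dlt].
have := @rho_near R d.+1 n f Q Qd.
have le_delta : delta R d f <= avg (fun x => nz R (f x + Q x)).
  by rewrite -distE; apply: delta_le; rewrite deg_lowdeg.
have -> : avg (fun x => nz R (f x + Q x)) <= 2 ^- d.+2.
  apply: le_trans (ltW dlt) _.
  by rewrite lef_pV2 ?posrE ?exprn_gt0 // ler_eXn2l; [lia | lra].
move=> /(_ isT); apply: le_trans; rewrite exprS.
have := ler_wpM2l (exprn_ge0 d (ler0n R 2)) le_delta; lra.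
Qed.

End GowersTest.

(** * Bernoulli estimates and the final comparison *)

Lemma exprn_1B_ge (R : realFieldType) (v : R) m : 0 <= v -> v <= 1 ->
  1 - m%:R * v <= (1 - v) ^+ m.
Proof.
move=> v0 v1; elim: m => [|m IH]; first by rewrite mul0r subr0.
rewrite exprS -natr1; have m0 : 0 <= m%:R :> R by [].
have H : 0 <= 1 - v by lra.
have := ler_wpM2l H IH; have : 0 <= m%:R * v * v by rewrite !mulr_ge0.
lra.
Qed.

Lemma exprn_1B_le (R : realFieldType) (v : R) m : 0 <= v -> v <= 1 ->
  (1 - v) ^+ m <= 1 - m%:R * v + (m%:R * v) ^+ 2 / 2.
Proof.
move=> v0 v1; elim: m => [|m IH]; first by rewrite expr0 mul0r expr0n /=; lra.
rewrite exprS -natr1; have m0 : 0 <= m%:R :> R by [].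
have H : 0 <= 1 - v by lra.
have := ler_wpM2l H IH; have : 0 <= v * v by rewrite mulr_ge0.
have : 0 <= (m%:R * v) ^+ 2 * v by rewrite mulr_ge0 // sqr_ge0.
lra.
Qed.

Unset Implicit Arguments.

Theorem theorem2 (R : realType) :
  exists eps c C : R,
    [/\ 0 < eps, 0 < c, c <= C &
      forall (d n : nat) (f : boolfun n),
        (1 <= n)%N ->
        1 - eps / 2 ^+ d <= gowers_norm R d.+1 f ->
        c * (1 - gowers_norm R d.+1 f) <= delta R d f /\
        delta R d f <= C * (1 - gowers_norm R d.+1 f)].
Proof.
(* With v = 1 - u and m = 2^(d+1), 2 rho = 1 - (1 - v)^m lies between m v / 2 and m v. The upper
   bound gives rho <= 2^d v <= 1/1024 < 1/512 and C = 1; the lower one with rho <= 2^(d+1) delta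
   gives c = 1/4. *)
exists (1 / 1024), (1 / 4), 1; split; [lra | lra | lra |] => d n f _.
have uX := gowers_normX R d f; have u0 := gowers_norm_ge0 R d.+1 f.
have r0 := rho_ge0 R d.+1 f.
have d0 : 0 < 2 ^+ d :> R by rewrite exprn_gt0.
set u := gowers_norm R d.+1 f in uX u0 *.
have u1 : u <= 1.
  rewrite -(@expr_le1 _ (2 ^ d.+1)) ?expn_gt0 // uX; lra.
rewrite -[u in u ^+ _](subKr 1) in uX.
set v := 1 - u in uX *; have v0 : 0 <= v by rewrite /v; lra.
have v1 : v <= 1 by rewrite /v; lra.
move=> u_ge; have v_le : v <= 1 / 1024 / 2 ^+ d by rewrite /v; lra.
have dv : 2 ^+ d * v <= 1 / 1024 by rewrite mulrC -ler_pdivlMr.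
have := exprn_1B_ge (2 ^ d.+1) v0 v1; have := exprn_1B_le (2 ^ d.+1) v0 v1.
rewrite uX natrX exprS => ub lb.
have rho_v : rho R d.+1 f <= 2 ^+ d * v by lra.
have rlt : rho R d.+1 f < 1 / 512 by lra.
have delta_rho := delta_le_rho rlt; have rho_delta := rho_le_delta R d f.
have dv0 : 0 <= 2 ^+ d * v by rewrite mulr_ge0 // ltW.
move: rho_delta; rewrite exprS => rho_delta.
have sq : (2 * 2 ^+ d * v) ^+ 2 <= 2 * 2 ^+ d * v by nra.
have lower : 2 ^+ d * (1 / 4 * v) <= 2 ^+ d * delta R d f by lra.
have upper : 2 ^+ d * delta R d f <= 2 ^+ d * (1 * v) by lra.
by split; rewrite -(ler_pM2l d0).
Qed.
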